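(* Let $n\ge 3$ and $m\ge 1$. Let $C_n$ be the cycle graph with vertices $a_1,\dots,a_n$ (edges $a_ia_{i+1}$, indices mod $n$) and $P_m$ the path graph with vertices $b_1,\dots,b_m$ (edges $b_ib_{i+1}$). For $1\le k\le \lceil m/2\rceil$, let $G_k$ be the wedge graph obtained from $C_n$ and $P_m$ by identifying $a_1$ with $b_k$ into a single vertex $c_k$. Then the independence complex $\mathcal{I}(G_k)$ is either contractible or homotopy equivalent to a wedge of spheres.
   Context: The wedge of graphs $G_1,G_2$ at chosen vertices $a_1\in G_1$, $a_2\in G_2$ is obtained from the disjoint union by identifying $a_1$ and $a_2$ into a single vertex (edges incident to $a_1$ or $a_2$ become incident to the new vertex). The independence complex $\mathcal{I}(G)$ is the simplicial complex whose simplices are the independent vertex sets of $G$. *)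

(* Defs.v *)
From HB Require Import structures.
From mathcomp Require Import all_boot all_order all_algebra.
From mathcomp Require Import all_classical all_reals topology normedtype.
From mathcomp Require Import homotopy.

Set Implicit Arguments.
Unset Strict Implicit.
Unset Printing Implicit Defensive.

Import Order.TTheory GRing.Theory Num.Theory.
Import numFieldNormedType.Exports.

Local Open Scope classical_set_scope.
Local Open Scope ring_scope.

Record sgraph := SGraph {
  vertex :> finType;
  adj : rel vertex;
  adj_sym : symmetric adj;
  adj_irr : irreflexive adj }.
Arguments adj {s} _ _.

Section CycleGraph.
Variables (n : nat) (hn : (3 <= n)%N).

                                                   
Definition cycle_adj : rel 'I_n :=
  fun i j => (nat_of_ord j == i.+1 %% n)%N || (nat_of_ord i == j.+1 %% n)%N.

Lemma cycle_adj_sym : symmetric cycle_adj.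
Proof. by move=> i j; rewrite /cycle_adj orbC. Qed.

Lemma cycle_adj_irr : irreflexive cycle_adj.
Proof.
move=> i; rewrite /cycle_adj orbb; apply/negbTE.
have := ltn_ord i; rewrite leq_eqVlt => /predU1P[e|lt].
  rewrite e modnn; apply/eqP => i0; move: e; rewrite i0 => e1.
  by move: hn; rewrite -e1.
by rewrite modn_small // neq_ltn ltnSn.
Qed.

Definition cycle_graph : sgraph := SGraph cycle_adj_sym cycle_adj_irr.

Lemma cycle_first_lt : (0 < n)%N.
Proof. exact: leq_trans hn. Qed.

Definition cycle_first : cycle_graph := Ordinal cycle_first_lt.

End CycleGraph.

Section PathGraph.
Variable m : nat.

                                                   
Definition path_adj : rel 'I_m :=
  fun i j => (nat_of_ord j == i.+1)%N || (nat_of_ord i == j.+1)%N.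

Lemma path_adj_sym : symmetric path_adj.
Proof. by move=> i j; rewrite /path_adj orbC. Qed.

Lemma path_adj_irr : irreflexive path_adj.
Proof. by move=> i; rewrite /path_adj orbb ltn_eqF. Qed.

Definition path_graph : sgraph := SGraph path_adj_sym path_adj_irr.

Lemma path_vertex_lt (k : nat) :
  (1 <= m)%N -> (1 <= k <= uphalf m)%N -> (k.-1 < m)%N.
Proof.
move=> hm /andP[k0 km]; rewrite prednK //; apply: leq_trans km _.
by rewrite leq_uphalf_double -addnn leq_addr.
Qed.

Definition path_vertex (k : nat) (hm : (1 <= m)%N)
    (hk : (1 <= k <= uphalf m)%N) : path_graph :=
  Ordinal (path_vertex_lt hm hk).

End PathGraph.

Section DisjointUnion.
Variables G1 G2 : sgraph.

Definition sum_adj : rel (G1 + G2)%type := fun x y =>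
  match x, y with
  | inl u, inl v => adj u v
  | inr u, inr v => adj u v
  | _, _ => false
  end.

Lemma sum_adj_sym : symmetric sum_adj.
Proof. by move=> [u|u] [v|v] //=; exact: adj_sym. Qed.

Lemma sum_adj_irr : irreflexive sum_adj.
Proof. by move=> [u|u] /=; exact: adj_irr. Qed.

Definition graph_sum : sgraph := SGraph sum_adj_sym sum_adj_irr.

End DisjointUnion.

Section GraphWedge.
Variables (G1 G2 : sgraph) (a1 : G1) (a2 : G2).

                                                                            
                                                                 
Definition wedge_vertex : finType := (G1 + {v : G2 | v != a2})%type.

Definition wedge_proj (x : graph_sum G1 G2) : wedge_vertex :=
  match x with
  | inl u => inl u
  | inr v => if insub v is Some w then inr w else inl a1
  end.

Definition wedge_adj : rel wedge_vertex := fun u v =>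
  [exists x : graph_sum G1 G2, exists y : graph_sum G1 G2,
    [&& adj x y, wedge_proj x == u & wedge_proj y == v]].

Lemma wedge_adj_sym : symmetric wedge_adj.
Proof.
suff h u v : wedge_adj u v -> wedge_adj v u by move=> u v; apply/idP/idP => /h.
move=> /existsP[x /existsP[y /and3P[xy xu yv]]].
by apply/existsP; exists y; apply/existsP; exists x; rewrite adj_sym xy xu yv.
Qed.

Lemma wedge_adj_irr : irreflexive wedge_adj.
Proof.
move=> u; apply/negbTE/existsPn => x; apply/existsPn => y.
apply/negP => /and3P[xy /eqP <-]; case: x y xy => [x|x] [y|y] //= xy.
  by move=> /eqP[yx]; move: xy; rewrite yx adj_irr.
case: insubP => [y' _ ey|]; case: insubP => [x' _ ex|] //.
  by move=> /eqP[e]; move: xy; rewrite -ey -ex e adj_irr.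
by rewrite !negbK => /eqP ex /eqP ey; move: xy; rewrite ex ey adj_irr.
Qed.

Definition graph_wedge : sgraph := SGraph wedge_adj_sym wedge_adj_irr.

End GraphWedge.

                                                                             
Record scomplex (V : finType) := SComplex {
  faces : {set {set V}};
  faces_sub : forall S T : {set V}, S \in faces -> T \subset S -> T \in faces }.

Section IndependenceComplex.
Variable G : sgraph.

Definition independent (S : {set G}) : bool :=
  [forall x in S, forall y in S, ~~ adj x y].

Lemma independent_sub (S T : {set G}) :
  S \in [set S | independent S]%SET -> T \subset S ->
  T \in [set S | independent S]%SET.
Proof.
rewrite !inE => /forall_inP hS /fintype.subsetP TS.
apply/forall_inP => x xT; apply/forall_inP => y yT.
by have /forall_inP := hS x (TS x xT); apply; exact: TS.
Qed.

Definition independence_complex : scomplex G := SComplex independent_sub.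

End IndependenceComplex.

                                                                           
          
Definition realization_set (R : realType) (V : finType) (K : scomplex V) :
    set {ptws V -> R} :=
  [set x : {ptws V -> R} | [/\ forall v, 0 <= x v,
     \sum_v x v = 1 & [set v | x v != 0]%SET \in faces K]].
Arguments realization_set R {V} K _.

Definition realization (R : realType) (V : finType) (K : scomplex V) :
    topologicalType :=
  set_type (realization_set R K).

(* H is only constrained on X x [0, 1]. *)
Definition homotopic (R : realType) (X Y : topologicalType) (f g : X -> Y) :=
  exists H : X * R -> Y,
    [/\ {within [set: X] `*` `[0, 1], continuous H},
        forall x, H (x, 0) = f x & forall x, H (x, 1) = g x].

Definition homotopy_equivalent (R : realType) (X Y : topologicalType) :=
  exists (f : X -> Y) (g : Y -> X),
    [/\ continuous f, continuous g,
        homotopic R (g \o f) idfun & homotopic R (f \o g) idfun].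

Definition contractible (R : realType) (X : topologicalType) :=
  exists x0 : X, homotopic R (@idfun X) (cst x0).

Definition sphere (R : realType) (d : nat) : set 'rV[R]_d.+1 :=
  [set x | \sum_i x 0 i ^+ 2 = 1].
Arguments sphere R d _ : clear implicits.

Lemma sphere_base_subproof (R : realType) (d : nat) :
  delta_mx 0 0 \in sphere R d.
Proof.
rewrite inE /sphere /= (bigD1 0) //= mxE !eqxx expr1n big1 ?addr0 // => i i0.
by rewrite mxE (negbTE i0) andbF expr0n.
Qed.

Definition sphere_base (R : realType) (d : nat) : sphere R d :=
  exist _ (delta_mx 0 0) (sphere_base_subproof R d).

                                                                         
              
Definition wedge_of_spheres (R : realType) (r : nat) (d : 'I_r.+1 -> nat) :
    topologicalType :=
  wedge (fun i => sphere_base R (d i)).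

(* Main.v *)
Require Import Defs.
From mathcomp Require Import all_boot all_order all_algebra.
From mathcomp Require Import all_classical all_reals topology normedtype.
From mathcomp Require Import homotopy realfun ring lra zify.

(** Independent sets are considered for symmetric relations with loops, a loop
    meaning that the vertex is deleted. If [w] is not adjacent to [u] or [v] and
    every neighbour of [w] is a neighbour of [u] or of [v], then adding the edge
    [uv] does not change the homotopy type: moving mass [min (x u) (x v)] from
    [u] and [v] to [w] retracts the complex onto the smaller one. For [u = v]
    this deletes [u], and it is the usual fold lemma. With such moves a tail
    or a path loses three vertices and leaves behind an isolated edge, and a
    cycle [a b c v ... u] becomes the edge [ab] and the cycle [v ... u]: add
    [uv] (with [w = b]), remove [ua] (with [w = c]), then fold [c] away. What
    remains is a set of disjoint edges together with an isolated vertex, with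
    nothing, or with a triangle. The first complex is a cone; the others are
    joins of [r + 2] points with a cross-polytope boundary of dimension
    [t - 1], that is, [r + 2] balls of dimension [t] glued along their boundary
    sphere; crushing one of the balls gives a wedge of [r + 1] spheres. *)

Set Implicit Arguments.
Unset Strict Implicit.
Unset Printing Implicit Defensive.

Import Order.TTheory GRing.Theory Num.Theory.
Import numFieldNormedType.Exports.

Local Open Scope classical_set_scope.
Local Open Scope ring_scope.

(** * Homotopies *)

(** The path has the form [l ++ c :: q] with [c] the wedge point, and only the lengths of [l] and
    [q] modulo 3 matter. Each tail is cut from its free end. Remainder 1 leaves a leaf at [c], which
    allows both cycle neighbours of [c] to be deleted; with remainder 2 the last cut deletes [c]
    itself. Either way the cycle opens and only disjoint paths are left. If both remainders are 0,
    the tails vanish and the cycle stands alone. So a triangle, and with it a wedge of two spheres,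
    arises only if both tails and the cycle have lengths divisible by 3; otherwise the result is a
    cone or a single sphere. The vertex type is fixed during the reductions: each of them compares
    two complexes in the same barycentric coordinates, and its homotopy runs along straight
    segments. *)

Lemma continuous_glue (I : finType) (X Y : topologicalType)
    (C : I -> set X) (F : I -> X -> Y) (f : X -> Y) :
  (forall i, closed (C i)) -> (forall i, continuous (F i)) ->
  (forall x, exists i, C i x) -> (forall i x, C i x -> f x = F i x) ->
  continuous f.
Proof.
move=> clC cF cov fF; apply/continuous_closedP => B clB.
rewrite (_ : f @^-1` B = \bigcup_(i in [set: I]) (C i `&` F i @^-1` B)).
  apply: closed_bigcup; first exact: finite_finset.
  by move=> i _; apply: closedI => //; move/continuous_closedP: (cF i); exact.
apply/seteqP; split=> x /=.
  by move=> Bx; have [i Ci] := cov x; exists i => //; split => //; rewrite /= -fF.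
by case=> i _ [Ci] /=; rewrite -fF.
Qed.

Lemma continuous_pair (X Y Z : topologicalType) (f : X -> Y) (g : X -> Z) :
  continuous f -> continuous g -> continuous (fun x => (f x, g x)).
Proof. by move=> cf cg x; apply: cvg_pair; [exact: cf|exact: cg]. Qed.

Lemma continuous_compose (X Y Z : topologicalType) (f : X -> Y) (g : Y -> Z) :
  continuous f -> continuous g -> continuous (fun x => g (f x)).
Proof. by move=> cf cg x; apply: continuous_comp; [exact: cf | exact: cg]. Qed.

Lemma continuous_fst (X Y : topologicalType) :
  continuous (fun p : X * Y => p.1).
Proof. by move=> p; exact: cvg_fst. Qed.

Lemma continuous_snd (X Y : topologicalType) :
  continuous (fun p : X * Y => p.2).
Proof. by move=> p; exact: cvg_snd. Qed.

Section Homotopy.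
Variable R : realType.

Section RealContinuity.
Context {T : topologicalType}.
Implicit Types f g : T -> R.

Lemma continuous_fun_cst (a : R) : continuous (fun _ : T => a).
Proof. exact: cst_continuous. Qed.

Lemma continuous_fun_add f g :
  continuous f -> continuous g -> continuous (fun x => f x + g x).
Proof. by move=> cf cg x; exact: (continuousD (cf x) (cg x)). Qed.

Lemma continuous_fun_opp f : continuous f -> continuous (fun x => - f x).
Proof. by move=> cf x; exact: (continuousN (cf x)). Qed.

Lemma continuous_fun_mul f g :
  continuous f -> continuous g -> continuous (fun x => f x * g x).
Proof. by move=> cf cg x; exact: (continuousM (cf x) (cg x)). Qed.

Lemma continuous_fun_inv f :
  (forall x, f x != 0) -> continuous f -> continuous (fun x => (f x)^-1).
Proof. by move=> f0 cf x; exact: (continuousV (f0 x) (cf x)). Qed.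

Lemma continuous_fun_norm f : continuous f -> continuous (fun x => `|f x|).
Proof. by move=> cf x; apply: (continuous_comp (cf x)); exact: norm_continuous. Qed.

Lemma continuous_fun_sqrt f :
  continuous f -> continuous (fun x => Num.sqrt (f x)).
Proof. by move=> cf x; apply: (continuous_comp (cf x)); exact: sqrt_continuous. Qed.

Lemma continuous_fun_max f g :
  continuous f -> continuous g -> continuous (fun x => Num.max (f x) (g x)).
Proof. by move=> cf cg x; exact: (continuous_max (cf x) (cg x)). Qed.

Lemma continuous_fun_min f g :
  continuous f -> continuous g -> continuous (fun x => Num.min (f x) (g x)).
Proof. by move=> cf cg x; exact: (continuous_min (cf x) (cg x)). Qed.

Lemma continuous_fun_sum (I : finType) (F : I -> T -> R) :
  (forall i, continuous (F i)) -> continuous (fun x => \sum_i F i x).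
Proof.
move=> cF; apply: continuous_big => //; exact: add_continuous.
Qed.

End RealContinuity.

Definition clamp (t : R) : R := Num.max 0 (Num.min 1 t).

Lemma clamp_continuous : continuous clamp.
Proof.
move=> t; apply: continuous_max; first exact: cst_continuous.
by apply: continuous_min; [exact: cst_continuous | exact: cvg_id].
Qed.

Lemma clamp_itv (t : R) : 0 <= clamp t <= 1.
Proof. by rewrite /clamp le_max lexx ge_max ler01 ge_min lexx. Qed.

Lemma clamp_le0 (t : R) : t <= 0 -> clamp t = 0.
Proof. by move=> t0; apply/max_idPl; rewrite ge_min t0 orbT. Qed.

Lemma clamp_ge1 (t : R) : 1 <= t -> clamp t = 1.
Proof. by move=> t1; rewrite /clamp (min_idPl t1) (max_idPr ler01). Qed.

Lemma clamp0 : clamp 0 = 0. Proof. exact: clamp_le0. Qed.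
Lemma clamp1 : clamp 1 = 1. Proof. exact: clamp_ge1. Qed.

Lemma homotopic_of_continuous (X Y : topologicalType) (f g : X -> Y)
    (H : X * R -> Y) :
  continuous H -> (forall x, H (x, 0) = f x) -> (forall x, H (x, 1) = g x) ->
  homotopic R f g.
Proof. by move=> cH H0 H1; exists H; split => //; exact: continuous_subspaceT. Qed.

(** [homotopic] controls [H] only over [0, 1]. Precomposing the time with [clamp] gives a map
    continuous on the whole product, after which times can be reparametrized without subspace
    topologies. *)
Lemma homotopicP (X Y : topologicalType) (f g : X -> Y) :
  homotopic R f g -> exists H : X * R -> Y,
    [/\ continuous H, forall x t, t <= 0 -> H (x, t) = f x &
        forall x t, 1 <= t -> H (x, t) = g x].
Proof.
move=> [H [cH H0 H1]]; exists (fun p => H (p.1, clamp p.2)); split.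
- have cc : continuous (fun p : X * R => (p.1, clamp p.2)).
    apply: continuous_pair => p; first exact: cvg_fst.
    by apply: continuous_comp; [exact: cvg_snd | exact: clamp_continuous].
  move=> p; pose A : set (X * R) := [set: X] `*` `[0, 1]%classic.
  apply: (@cvg_comp _ _ _ (fun p : X * R => (p.1, clamp p.2)) H _
    (nbhs ((p.1, clamp p.2) : subspace A))); last exact: cH.
  apply/subspace_cvgP; last first.
    move=> U wU; have := cc p _ wU; rewrite !nbhs_simpl /=.
    apply: (@filterS _ (nbhs p)) => q /=; apply.
    by split => //=; rewrite in_itv /=; exact: clamp_itv.
  by split => //=; rewrite in_itv /=; exact: clamp_itv.
- by move=> x t t0; rewrite /= clamp_le0 ?H0.
- by move=> x t t1; rewrite /= clamp_ge1 ?H1.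
Qed.

Lemma homotopic_refl (X Y : topologicalType) (f : X -> Y) :
  continuous f -> homotopic R f f.
Proof.
move=> cf; apply: (@homotopic_of_continuous _ _ _ _ (fun p => f p.1)) => // p.
by apply: continuous_comp; [exact: cvg_fst | exact: cf].
Qed.

Lemma homotopic_sym (X Y : topologicalType) (f g : X -> Y) :
  homotopic R f g -> homotopic R g f.
Proof.
move=> /homotopicP[H [cH H0 H1]].
apply: (@homotopic_of_continuous _ _ _ _ (fun p => H (p.1, 1 - p.2))).
- move=> p; apply: (@continuous_comp _ _ _ (fun p : X * R => (p.1, 1 - p.2))).
    apply: (continuous_pair (f := fst)) => {p}; first by move=> p; exact: cvg_fst.
    apply: continuous_fun_add; first exact: continuous_fun_cst.
    by apply: continuous_fun_opp => p; exact: cvg_snd.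
  exact: cH.
- by move=> x /=; rewrite subr0 H1.
- by move=> x /=; rewrite subrr H0.
Qed.

Lemma homotopic_trans (X Y : topologicalType) (f g h : X -> Y) :
  homotopic R f g -> homotopic R g h -> homotopic R f h.
Proof.
move=> /homotopicP[H [cH H0 H1]] /homotopicP[K [cK K0 K1]].
have caff (a : R) : continuous (fun p : X * R => (p.1, 2 * p.2 - a)).
  apply: continuous_pair => p; first exact: cvg_fst.
  move: p; apply: continuous_fun_add; last exact: continuous_fun_cst.
  by apply: continuous_fun_mul => p; [exact: cst_continuous | exact: cvg_snd].
pose C (b : bool) : set (X * R) := [set p | if b then p.2 <= 1 / 2 else 1 / 2 <= p.2].
pose F (b : bool) (p : X * R) := if b then H (p.1, 2 * p.2 - 0) else K (p.1, 2 * p.2 - 1).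
apply: (@homotopic_of_continuous _ _ _ _ (fun p => F (p.2 <= 1 / 2) p)).
- apply: (@continuous_glue bool _ _ C F).
  + move=> [].
      rewrite /C (_ : mkset _ = snd @^-1` [set x : R | x <= 1 / 2]) //.
      by apply: preimage_closed; [move=> ? _; exact: cvg_snd | exact: closed_le].
    rewrite /C (_ : mkset _ = snd @^-1` [set x : R | 1 / 2 <= x]) //.
    by apply: preimage_closed; [move=> ? _; exact: cvg_snd | exact: closed_ge].
  + move=> [] p; rewrite /F.
      by apply: (continuous_comp (caff 0 p)); exact: cH.
    by apply: (continuous_comp (caff 1 p)); exact: cK.
  + by move=> p; exists (p.2 <= 1 / 2); rewrite /C /=; case: leP => // /ltW.
  + move=> [] [x t]; rewrite /C /= => ht; first by rewrite ht.
    case: leP => // ht'; rewrite /F /=.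
    have -> : t = 1 / 2 by lra.
    by rewrite H1 ?K0 //; lra.
- by move=> x; rewrite /F /= ifT ?H0 //; lra.
- by move=> x; rewrite /F /= ifF ?K1 //; first lra; apply/negbTE; lra.
Qed.

Lemma homotopic_comp2l (X Y Z : topologicalType) (f g : X -> Y) (h : Y -> Z) :
  continuous h -> homotopic R f g -> homotopic R (h \o f) (h \o g).
Proof.
move=> ch /homotopicP[H [cH H0 H1]].
apply: (@homotopic_of_continuous _ _ _ _ (h \o H)) => /=.
- by move=> p; apply: continuous_comp; [exact: cH | exact: ch].
- by move=> x; rewrite H0.
- by move=> x; rewrite H1.
Qed.

Lemma homotopic_comp2r (X Y Z : topologicalType) (f g : Y -> Z) (h : X -> Y) :
  continuous h -> homotopic R f g -> homotopic R (f \o h) (g \o h).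
Proof.
move=> ch /homotopicP[H [cH H0 H1]].
apply: (@homotopic_of_continuous _ _ _ _ (fun p => H (h p.1, p.2))) => /=.
- move=> p; apply: (@continuous_comp _ _ _ (fun p : X * R => (h p.1, p.2))); last exact: cH.
  move: p; apply: continuous_pair => p; last exact: cvg_snd.
  by apply: continuous_comp; [exact: cvg_fst | exact: ch].
- by move=> x; rewrite H0.
- by move=> x; rewrite H1.
Qed.

Lemma homotopy_equivalent_sym (X Y : topologicalType) :
  homotopy_equivalent R X Y -> homotopy_equivalent R Y X.
Proof. by move=> [f [g [cf cg h1 h2]]]; exists g, f; split. Qed.

Lemma homotopy_equivalent_trans (X Y Z : topologicalType) :
  homotopy_equivalent R X Y -> homotopy_equivalent R Y Z ->
  homotopy_equivalent R X Z.
Proof.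
move=> [f [g [cf cg gf fg]]] [h [k [ch ck kh hk]]].
exists (h \o f), (g \o k); split.
- by move=> x; apply: continuous_comp; [exact: cf | exact: ch].
- by move=> x; apply: continuous_comp; [exact: ck | exact: cg].
- apply: homotopic_trans gf.
  exact: (homotopic_comp2l cg (homotopic_comp2r cf kh)).
- apply: homotopic_trans hk.
  exact: (homotopic_comp2l ch (homotopic_comp2r ck fg)).
Qed.

Lemma contractible_homotopy_equivalent (X Y : topologicalType) :
  homotopy_equivalent R X Y -> contractible R Y -> contractible R X.
Proof.
move=> [f [g [cf cg gf _]]] [y0 hy]; exists (g y0).
apply: homotopic_trans (homotopic_sym gf) _.
exact: (homotopic_comp2l cg (homotopic_comp2r cf hy)).
Qed.

End Homotopy.

(** * Maps between realizations *)

Section Realization.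
Variable R : realType.

Definition weight (V : finType) (K : scomplex V) (x : realization R K) (v : V) : R :=
  (set_val x : {ptws V -> R}) v.

Definition to_realization (V : finType) (K : scomplex V) (x : V -> R)
    (h : realization_set R K x) : realization R K :=
  exist _ (x : {ptws V -> R}) (mem_set h).

Lemma weight_to_realization (V : finType) (K : scomplex V) (x : V -> R)
    (h : realization_set R K x) : weight (to_realization h) = x.
Proof. by rewrite /weight set_valE. Qed.

Lemma weightP (V : finType) (K : scomplex V) (x : realization R K) :
  realization_set R K (weight x).
Proof. by case: x => x hx; rewrite /weight set_valE /=; exact: set_mem. Qed.

Lemma weight_ge0 (V : finType) (K : scomplex V) (x : realization R K) v :
  0 <= weight x v.
Proof. by have [] := weightP x. Qed.

Lemma weight_sum (V : finType) (K : scomplex V) (x : realization R K) :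
  \sum_v weight x v = 1.
Proof. by have [] := weightP x. Qed.

Lemma weight_inj (V : finType) (K : scomplex V) : injective (@weight V K).
Proof. by move=> x y exy; apply: val_inj. Qed.

Lemma weight_continuous (V : finType) (K : scomplex V) v :
  continuous (fun x : realization R K => weight x v).
Proof.
move=> x; apply: (@continuous_comp _ {ptws V -> R} _ set_val (proj v)).
  exact: initial_continuous.
exact: proj_continuous.
Qed.

Lemma realization_continuous (V : finType) (K : scomplex V)
    (Y : topologicalType) (f : Y -> realization R K) :
  (forall v, continuous (fun y => weight (f y) v)) -> continuous f.
Proof.
move=> cf; apply: continuous_comp_initial => y.
apply/cvg_sup => v; move: y; apply: continuous_comp_initial.
exact: cf.
Qed.

(** Convex combinations of [f y] and [g y] are supported in the union of the two supports; as that
    union is a face, the segment stays in the complex. *)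
Lemma straight_homotopic (V : finType) (K : scomplex V) (Y : topologicalType)
    (f g : Y -> realization R K) :
  continuous f -> continuous g ->
  (forall y, [set v | (weight (f y) v != 0) || (weight (g y) v != 0)]%SET
     \in faces K) ->
  homotopic R f g.
Proof.
move=> cf cg fgK.
pose h (p : Y * R) v :=
  (1 - clamp p.2) * weight (f p.1) v + clamp p.2 * weight (g p.1) v.
have hK p : realization_set R K (h p).
  have /andP[c0 c1] := clamp_itv p.2; split.
  - move=> v; rewrite /h; have := weight_ge0 (f p.1) v; have := weight_ge0 (g p.1) v.
    by move=> ? ?; apply: addr_ge0; apply: mulr_ge0 => //; rewrite subr_ge0.
  - by rewrite /h big_split /= -!mulr_sumr !weight_sum !mulr1 subrK.
  - apply: (faces_sub (fgK p.1)); apply/fintype.subsetP => v; rewrite !inE.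
    apply: contraR; rewrite negb_or !negbK /h => /andP[/eqP-> /eqP->].
    by rewrite !mulr0 addr0.
apply: (@homotopic_of_continuous _ _ _ _ _ (fun p => to_realization (hK p))).
- apply: realization_continuous => v.
  under [X in continuous X]eq_fun do rewrite weight_to_realization.
  have cc : continuous (fun p : Y * R => clamp p.2).
    by move=> p; apply: continuous_comp; [exact: cvg_snd | exact: clamp_continuous].
  have cw (k : Y -> realization R K) : continuous k ->
      continuous (fun p : Y * R => weight (k p.1) v).
    move=> ck; exact: (continuous_compose (continuous_compose (@continuous_fst _ _) ck)
      (@weight_continuous _ _ v)).
  apply: continuous_fun_add; apply: continuous_fun_mul; [|exact: cw|exact: cc|exact: cw].
  apply: continuous_fun_add; first exact: continuous_fun_cst.
  exact: continuous_fun_opp.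
- move=> y; apply: weight_inj; rewrite weight_to_realization /h clamp0.
  by apply/funext => v /=; rewrite subr0 mul1r mul0r addr0.
- move=> y; apply: weight_inj; rewrite weight_to_realization /h clamp1.
  by apply/funext => v /=; rewrite subrr mul1r mul0r add0r.
Qed.

(** [rho] and the inclusion of [K'] are mutually inverse: one composite is the identity, the other
    is joined to it by segments, because [x] and [rho x] lie in a common face. *)
Lemma retraction_equivalent (V : finType) (K K' : scomplex V)
    (rho : (V -> R) -> V -> R) :
  faces K' \subset faces K ->
  (forall x, realization_set R K x -> realization_set R K' (rho x)) ->
  (forall x, realization_set R K x ->
     [set v | (rho x v != 0) || (x v != 0)]%SET \in faces K) ->
  (forall x, realization_set R K' x -> rho x = x) ->
  (forall v, continuous (fun x : realization R K => rho (weight x) v)) ->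
  homotopy_equivalent R (realization R K) (realization R K').
Proof.
move=> /fintype.subsetP sK'K rK' rK rid crho.
have inK (x : realization R K') : realization_set R K (weight x).
  by have [] := weightP x; split => //; exact: sK'K.
exists (fun x => to_realization (rK' _ (weightP x))),
  (fun x => to_realization (inK x)).
have cr : continuous (fun x => to_realization (rK' _ (weightP x))).
  apply: realization_continuous => v.
  by under [X in continuous X]eq_fun do rewrite weight_to_realization; exact: crho.
have ci : continuous (fun x => to_realization (inK x)).
  apply: realization_continuous => v.
  under [X in continuous X]eq_fun do rewrite weight_to_realization.
  exact: weight_continuous.
split => //.
- apply: straight_homotopic.
  + by move=> x; apply: continuous_comp; [exact: cr | exact: ci].
  + by move=> x; exact: cvg_id.
  + move=> x /=; rewrite !weight_to_realization; apply: rK; exact: weightP.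
- rewrite (_ : _ \o _ = idfun).
    by apply: homotopic_refl => x; exact: cvg_id.
  apply/funext => x; apply: weight_inj; rewrite /= !weight_to_realization.
  by apply: rid; exact: weightP.
Qed.

End Realization.

(** * Independence complexes of relations *)

Section StableComplex.
Variable V : finType.
Implicit Types e : rel V.

Definition stable e (S : {set V}) :=
  [forall x in S, forall y in S, ~~ e x y].

Lemma stableP e (S : {set V}) :
  reflect {in S &, forall x y, ~~ e x y} (stable e S).
Proof.
apply: (iffP forall_inP) => [h x y xS yS|h x xS]; last first.
  by apply/forall_inP => y yS; exact: h.
by have /forall_inP := h x xS; apply.
Qed.

Lemma stable_sub e (S T : {set V}) :
  S \in [set S | stable e S]%SET -> T \subset S -> T \in [set S | stable e S]%SET.
Proof.
rewrite !inE => /stableP hS /fintype.subsetP TS.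
by apply/stableP => x y xT yT; apply: hS; exact: TS.
Qed.

(* A loop of [e] at [v] removes [v] from the complex, so that deleting a vertex
   amounts to adding an edge. *)
Definition stable_complex e : scomplex V := SComplex (@stable_sub e).

Definition add_edge e u v : rel V :=
  fun a b => [|| e a b, (a == u) && (b == v) | (a == v) && (b == u)].

End StableComplex.

Section StableSpace.
Variable R : realType.

Definition stable_space (V : finType) (e : rel V) : topologicalType :=
  realization R (stable_complex e).

Lemma stable_setP (V : finType) (e : rel V) (x : V -> R) :
  realization_set R (stable_complex e) x <->
  [/\ forall v, 0 <= x v, \sum_v x v = 1 &
      forall a b, x a != 0 -> x b != 0 -> ~~ e a b].
Proof.
split=> -[x0 x1 xe]; split => //.
  by move=> a b xa xb; move: xe; rewrite inE => /stableP; apply; rewrite inE.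
by rewrite inE; apply/stableP => a b; rewrite !inE; exact: xe.
Qed.

Lemma add_edge_equivalent (V : finType) (e : rel V) (u v w : V) :
  symmetric e -> w != u -> w != v -> ~~ e w w -> ~~ e w u -> ~~ e w v ->
  (forall y, e w y -> e u y || e v y) ->
  homotopy_equivalent R (stable_space e) (stable_space (add_edge e u v)).
Proof.
move=> es wu wv eww ewu ewv nw.
pose t (x : V -> R) := Num.min (x u) (x v).
pose uv (y : V) := (y == u) || (y == v).
(* The sum over [uv] is 2 if [u] and [v] differ and 1 if [u = v]; with it one formula conserves the
   total mass both for an added edge and for a deleted vertex. *)
pose rho (x : V -> R) (y : V) :=
  x y - t x * (uv y)%:R + t x * (\sum_z (uv z)%:R) * (y == w)%:R.
have sum_uv : 0 <= \sum_z (uv z)%:R :> R by apply: sumr_ge0.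
have rho0 x : t x = 0 -> rho x = x.
  by move=> tx; apply/funext => y; rewrite /rho tx !mul0r subr0 addr0.
have t_ge0 x : (forall y, 0 <= x y) -> 0 <= t x.
  by move=> x0; rewrite /t le_min !x0.
have t_gt0 x : (forall y, 0 <= x y) -> t x != 0 -> x u != 0 /\ x v != 0.
  move=> x0 tx; have : 0 < t x by rewrite lt_def tx t_ge0.
  by rewrite /t lt_min => /andP[xu xv]; rewrite !gt_eqF.
have supp x y : (forall y, 0 <= x y) -> rho x y != 0 ->
    x y != 0 \/ y = w /\ t x != 0.
  move=> x0; have [tx|tx] := eqVneq (t x) 0; first by rewrite rho0 //; left.
  have [->|yw] := eqVneq y w; first by right.
  move=> ryx; left; apply: contra ryx => /eqP xy.
  have -> : rho x y = 0 => //.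
  rewrite /rho xy (negbTE yw) mulr0 addr0 sub0r.
  suff -> : uv y = false by rewrite mulr0 oppr0.
  have [xu xv] := t_gt0 _ x0 tx.
  by apply/negP => /orP[] /eqP ey; move: xu xv; rewrite -ey xy eqxx.
(* If [t x] is nonzero, then [u] and [v] are in the support, so a neighbour of [w] in the support
   would be adjacent to one of them. Hence [w] can join the support. *)
have suppw x a b : (forall y, 0 <= x y) ->
    (forall a b, x a != 0 -> x b != 0 -> ~~ e a b) ->
    x a != 0 \/ a = w /\ t x != 0 -> x b != 0 \/ b = w /\ t x != 0 -> ~~ e a b.
  move=> x0 xe.
  have ew c : x c != 0 -> t x != 0 -> ~~ e w c.
    move=> xc /(t_gt0 _ x0)[xu xv]; apply/negP => /nw /orP[] ec.
      by have := xe _ _ xu xc; rewrite ec.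
    by have := xe _ _ xv xc; rewrite ec.
  move=> [xa|[-> tx]] [xb|[-> tx']] //; first exact: xe.
    by rewrite es; exact: ew.
  exact: ew.
apply: (@retraction_equivalent _ _ _ _ rho).
- apply/fintype.subsetP => S; rewrite !inE => /stableP hS; apply/stableP => a b aS bS.
  by have := hS a b aS bS; rewrite /add_edge negb_or => /andP[].
- move=> x /stable_setP[x0 x1 xe]; apply/stable_setP; split.
  + move=> y; rewrite /rho; apply: addr_ge0; last first.
      by apply: mulr_ge0 => //; apply: mulr_ge0 => //; exact: t_ge0.
    rewrite subr_ge0 /uv; case: (eqVneq y u) => [->|_].
      by rewrite mulr1 /t ge_min lexx.
    case: (eqVneq y v) => [->|_]; last by rewrite mulr0.
    by rewrite mulr1 /t ge_min lexx orbT.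
  + rewrite /rho !big_split /= x1 sumrN -!mulr_sumr.
    have -> : \sum_i (i == w)%:R = 1 :> R.
      by rewrite (bigD1 w) //= eqxx big1 ?addr0 // => i /negbTE ->.
    by rewrite mulr1 subrK.
  + move=> a b ra rb; rewrite /add_edge negb_or; apply/andP; split.
      by apply: (suppw x) => //; exact: supp.
    have ruv : ~~ ((rho x u != 0) && (rho x v != 0)).
      rewrite negb_and !negbK /rho /uv !eqxx !orbT /= ![_ == w]eq_sym.
      rewrite (negbTE wu) (negbTE wv) !mulr0 !addr0 !mulr1 !subr_eq0 /t.
      by case: leP; rewrite eqxx ?orbT.
    by apply: contra ruv => /orP[] /andP[/eqP <- /eqP <-]; rewrite ra rb.
- move=> x /stable_setP[x0 x1 xe]; rewrite inE; apply/stableP => a b.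
  rewrite !inE => ha hb; apply: (suppw x) => //.
    by case/orP: ha => [/(supp _ _ x0)//|]; left.
  by case/orP: hb => [/(supp _ _ x0)//|]; left.
- move=> x /stable_setP[x0 x1 xe]; apply: rho0; apply/eqP.
  apply: contraT => /(t_gt0 _ x0)[xu xv].
  by have := xe u v xu xv; rewrite /add_edge !eqxx orbT.
- move=> y; have cw z := @weight_continuous R V (stable_complex e) z.
  have ct : continuous (fun x : stable_space e => t (weight x)).
    exact: continuous_fun_min.
  apply: continuous_fun_add; first apply: continuous_fun_add => //.
    apply: continuous_fun_opp; apply: continuous_fun_mul => //.
    exact: continuous_fun_cst.
  apply: continuous_fun_mul; last exact: continuous_fun_cst.
  by apply: continuous_fun_mul => //; exact: continuous_fun_cst.
Qed.

(** The complex is a cone with apex [w]. The condition on [y] concerns loopless vertices because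
    only these carry weight. *)
Lemma isolated_contractible (V : finType) (e : rel V) (w : V) :
  ~~ e w w -> (forall y, ~~ e y y -> ~~ e w y && ~~ e y w) ->
  contractible R (stable_space e).
Proof.
move=> eww ew.
have hw : realization_set R (stable_complex e) (fun v => (v == w)%:R).
  apply/stable_setP; split => //.
    by rewrite (bigD1 w) //= eqxx big1 ?addr0 // => i /negbTE ->.
  by move=> a b; case: (eqVneq a w) => [->|]; case: (eqVneq b w) => [->|]; rewrite ?eqxx.
exists (to_realization hw); apply: straight_homotopic.
- by move=> x; exact: cvg_id.
- exact: cst_continuous.
- move=> x; rewrite inE; apply/stableP => a b.
  rewrite !inE /cst weight_to_realization.
  have /stable_setP[_ _ xe] := weightP x.
  have [->|aw] := eqVneq a w; have [->|bw] := eqVneq b w; rewrite ?eqxx /= ?orbF //.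
  - by move=> _ xb; have /andP[] := ew b (xe b b xb xb).
  - by move=> xa _; have /andP[] := ew a (xe a a xa xa).
  - exact: xe.
Qed.

(** A vertex with a loop has weight 0 at every point, so restricting coordinates along [i] and
    extending by 0 are inverse to each other. This is how deleted vertices finally leave the vertex
    type. *)
Lemma stable_space_iso (V L : finType) (e : rel V) (e' : rel L) (i : L -> V) :
  injective i -> (forall v, ~~ e v v -> v \in codom i) ->
  (forall a b, e (i a) (i b) = e' a b) ->
  homotopy_equivalent R (stable_space e) (stable_space e').
Proof.
move=> inji live ei.
have zero (x : V -> R) v : (forall a b, x a != 0 -> x b != 0 -> ~~ e a b) ->
    v \notin codom i -> x v = 0.
  by move=> xe vi; apply/eqP; apply: contraNT vi => xv; exact/live/xe.
have hf (x : stable_space e) :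
    realization_set R (stable_complex e') (fun l => weight x (i l)).
  have /stable_setP[x0 x1 xe] := weightP x; apply/stable_setP; split => //.
    rewrite -x1 [RHS](bigID (mem (codom i))) /= [X in _ + X]big1 ?addr0; last first.
      by move=> v; exact: zero.
    rewrite (eq_bigl [in (i @: [set: L])%SET]); last first.
      move=> v; apply/codomP/imsetP => [[l ->]|[l _ ->]]; last by exists l.
      by exists l => //; rewrite inE.
    rewrite big_imset /=; last by move=> ? ? _ _ /inji.
    by apply: eq_bigl => l; rewrite inE.
  by move=> a b xa xb; rewrite -ei; exact: xe.
pose ext (y : L -> R) v := \sum_(l | i l == v) y l.
have extE y l : ext y (i l) = y l.
  rewrite /ext (big_pred1 l) // => l' /=.
  by apply/eqP/eqP => [/inji|->].
have ext0 y v : v \notin codom i -> ext y v = 0.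
  move=> vi; rewrite /ext big1 // => l /eqP lv; case/negP: vi.
  by rewrite -lv; exact: codom_f.
have hg (y : stable_space e') :
    realization_set R (stable_complex e) (ext (weight y)).
  have /stable_setP[y0 y1 ye] := weightP y; apply/stable_setP; split.
  - by move=> v; apply: sumr_ge0.
  - rewrite -y1 /ext (exchange_big_dep xpredT) //=; apply: eq_bigr => l _.
    by rewrite (big_pred1 (i l)) // => v; rewrite /= eq_sym.
  - move=> a b; case: (boolP (a \in codom i)) => [/codomP[l ->]|/ext0->]; last by rewrite eqxx.
    case: (boolP (b \in codom i)) => [/codomP[l' ->]|/ext0->]; last by rewrite eqxx.
    by rewrite !extE ei; exact: ye.
exists (fun x => to_realization (hf x)), (fun y => to_realization (hg y)).
have cf : continuous (fun x => to_realization (hf x)).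
  apply: realization_continuous => l.
  under [X in continuous X]eq_fun do rewrite weight_to_realization.
  exact: weight_continuous.
have cg : continuous (fun y => to_realization (hg y)).
  apply: realization_continuous => v.
  under [X in continuous X]eq_fun do rewrite weight_to_realization /ext.
  apply: continuous_big => [|l _]; first exact: add_continuous.
  exact: weight_continuous.
split => //.
- rewrite (_ : _ \o _ = idfun); first by apply: homotopic_refl => x; exact: cvg_id.
  apply/funext => x; apply: weight_inj; rewrite /= !weight_to_realization.
  apply/funext => v; case: (boolP (v \in codom i)) => [/codomP[l ->]|vi].
    by rewrite extE.
  by rewrite ext0 //; apply/esym/zero => //; have /stable_setP[] := weightP x.
- rewrite (_ : _ \o _ = idfun); first by apply: homotopic_refl => x; exact: cvg_id.
  apply/funext => y; apply: weight_inj; rewrite /= !weight_to_realization.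
  by apply/funext => l; rewrite extE.
Qed.

End StableSpace.

(** * Spheres *)

Lemma matrix_continuous (T : topologicalType) (U : topologicalType) m n
    (f : T -> 'M[U]_(m, n)) :
  (forall i j, continuous (fun x => f x i j)) -> continuous f.
Proof.
move=> cf x A /= [P nP PA].
have : \forall y \near x, forall i j, P i j (f y i j).
  apply: filter_forall => i; apply: filter_forall => j.
  exact: (cf i j x (P i j) (nP i j)).
by apply: filterS => y Py; exact: PA.
Qed.

Section Sphere.
Variables (R : realType) (t : nat).
Implicit Types (v : 'I_t.+1 -> R).

Definition sphere_point : topologicalType := set_type (sphere R t).

Definition coordinate (z : sphere_point) : 'I_t.+1 -> R :=
  fun i => (set_val z : 'rV[R]_t.+1) ord0 i.

Definition sqnorm v := \sum_i v i ^+ 2.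

Lemma sqnorm_ge0 v : 0 <= sqnorm v.
Proof. by apply: sumr_ge0 => i _; exact: sqr_ge0. Qed.

Lemma sqnorm_eq0 v : sqnorm v = 0 -> forall i, v i = 0.
Proof.
move=> /eqP; rewrite psumr_eq0; last by move=> i _; exact: sqr_ge0.
by move=> /allP h i; have := h i (mem_index_enum _); rewrite /= sqrf_eq0 => /eqP.
Qed.

Lemma sqnorm_coordinate z : sqnorm (coordinate z) = 1.
Proof. by case: z => z hz; rewrite /sqnorm /coordinate set_valE /=; exact: (set_mem hz). Qed.

Lemma coordinate_inj : injective coordinate.
Proof.
move=> x y exy; apply: val_inj; apply/rowP => i.
by have := congr1 (fun h => h i) exy; rewrite /coordinate !set_valE.
Qed.

Lemma coordinate_base i : coordinate (sphere_base R t) i = (i == ord0)%:R.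
Proof. by rewrite /coordinate set_valE /= mxE eqxx. Qed.

Lemma coordinate_continuous i : continuous (fun z => coordinate z i).
Proof.
apply: (continuous_compose (f := set_val) (g := fun M : 'rV[R]_t.+1 => M ord0 i)).
  exact: initial_continuous.
exact: coord_continuous.
Qed.

Definition normalize v i := v i / Num.sqrt (sqnorm v).

Lemma normalize_subproof v :
  (if sqnorm v == 0 then delta_mx 0 0 else \row_i normalize v i) \in sphere R t.
Proof.
case: eqP => [_|/eqP v0]; first exact: sphere_base_subproof.
rewrite inE /sphere /=; under eq_bigr do rewrite mxE expr_div_n sqr_sqrtr ?sqnorm_ge0 //.
by rewrite -mulr_suml mulfV.
Qed.

(* The zero vector is sent to the base point. *)
Definition to_sphere v : sphere_point :=
  @exist _ (fun x => x \in sphere R t) _ (normalize_subproof v).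

Lemma coordinate_to_sphere v i :
  sqnorm v != 0 -> coordinate (to_sphere v) i = normalize v i.
Proof. by move=> /negbTE v0; rewrite /coordinate set_valE /= v0 mxE. Qed.

Lemma to_sphere_coordinate z : to_sphere (coordinate z) = z.
Proof.
apply: coordinate_inj; apply/funext => i.
by rewrite coordinate_to_sphere ?sqnorm_coordinate ?oner_eq0 // /normalize
  sqnorm_coordinate sqrtr1 divr1.
Qed.

Lemma to_sphere_scale (c : R) v : 0 < c -> to_sphere (fun i => c * v i) = to_sphere v.
Proof.
move=> c0; have cE : sqnorm (fun i => c * v i) = c ^+ 2 * sqnorm v.
  by rewrite /sqnorm mulr_sumr; apply: eq_bigr => i _; rewrite exprMn.
apply: val_inj => /=; rewrite cE mulf_eq0 sqrf_eq0 gt_eqF //=.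
case: eqP => // _; apply/rowP => i; rewrite !mxE /normalize cE.
rewrite sqrtrM ?sqr_ge0 // sqrtr_sqr gtr0_norm // invfM.
by rewrite mulrACA divff ?mul1r // gt_eqF.
Qed.

Lemma to_sphere_base v :
  0 < v ord0 -> (forall i, i != ord0 -> v i = 0) -> to_sphere v = sphere_base R t.
Proof.
move=> v0 vi; rewrite -[RHS]to_sphere_coordinate -[RHS](to_sphere_scale _ v0).
congr to_sphere; apply/funext => i; rewrite coordinate_base.
by case: eqVneq => [->|/vi ->]; rewrite ?mulr1 ?mulr0.
Qed.

Lemma to_sphere_continuous (T : topologicalType) (f : T -> 'I_t.+1 -> R) :
  (forall i, continuous (fun x => f x i)) -> (forall x, sqnorm (f x) != 0) ->
  continuous (fun x => to_sphere (f x)).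
Proof.
move=> cf f0; apply: continuous_comp_initial; apply: matrix_continuous => i j.
rewrite (_ : (fun x => _) = fun x => normalize (f x) j); last first.
  apply/funext => x; rewrite -coordinate_to_sphere // /coordinate.
  by rewrite (ord1 i).
apply: continuous_fun_mul => //; apply: continuous_fun_inv.
  by move=> x; rewrite gt_eqF // sqrtr_gt0 lt_def f0 sqnorm_ge0.
apply: continuous_fun_sqrt; apply: continuous_fun_sum => k.
exact: continuous_fun_mul.
Qed.

(** On the unit sphere a first coordinate of at least 1 forces the others to vanish, which makes the
    base point the preimage of a closed half-line. *)
Lemma closed_sphere_base : closed [set sphere_base R t : sphere_point].
Proof.
rewrite (_ : [set _] = (fun z => coordinate z ord0) @^-1` [set a : R | 1 <= a]).
  apply: preimage_closed; last exact: closed_ge.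
  by move=> z _; exact: coordinate_continuous.
apply/seteqP; split => z /=; first by move=> ->; rewrite coordinate_base eqxx.
move=> z1; have : sqnorm (coordinate z) = 1 := sqnorm_coordinate z.
rewrite /sqnorm big_ord_recl => zE.
have s0 : 0 <= \sum_(i < t) coordinate z (lift ord0 i) ^+ 2.
  by apply: sumr_ge0 => i _; exact: sqr_ge0.
have z0 : coordinate z ord0 = 1 by nra.
have /eqP : \sum_(i < t) coordinate z (lift ord0 i) ^+ 2 = 0 by nra.
rewrite psumr_eq0; last by move=> i _; exact: sqr_ge0.
move=> /allP h; apply: coordinate_inj; apply/funext => i; rewrite coordinate_base.
case: (unliftP ord0 i) => [j ->|->]; last by rewrite eqxx.
by have := h j (mem_index_enum _); rewrite /= sqrf_eq0 => /eqP.
Qed.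

(* A homotopy from the identity to a map that crushes the hemisphere around the
   base point. *)
Definition crush_vector (s : R) v : 'I_t.+1 -> R := fun i =>
  if i == ord0 then v ord0 + s / 2
  else (1 - s + s * Num.max (- v ord0) 0) * v i.

Definition crush s z := to_sphere (crush_vector s (coordinate z)).

(** If the vector were 0, the first coordinate of [z] would be [- (s / 2)]. The factor of the other
    coordinates is then [1 - s + s ^+ 2 / 2], which is positive, so they vanish and the unit norm
    reads [s ^+ 2 / 4 = 1], impossible for [s <= 1]. *)
Lemma crush_vector_neq0 s z :
  0 <= s <= 1 -> sqnorm (crush_vector s (coordinate z)) != 0.
Proof.
move=> s01; apply/eqP => /sqnorm_eq0 h.
have := h ord0; rewrite /crush_vector eqxx => z0.
have hz0 : coordinate z ord0 = - (s / 2) by lra.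
have c0 : 0 < 1 - s + s * Num.max (- coordinate z ord0) 0.
  rewrite hz0 opprK; have -> : Num.max (s / 2) 0 = s / 2 by apply/max_idPl; lra.
  nra.
have hi i : i != ord0 -> coordinate z i = 0.
  move=> i0; have := h i; rewrite /crush_vector (negbTE i0) => /eqP.
  by rewrite mulf_eq0 gt_eqF //= => /eqP.
have := sqnorm_coordinate z.
rewrite /sqnorm (bigD1 ord0) //= big1 => [|i /hi ->]; last by rewrite expr0n.
by rewrite hz0; nra.
Qed.

Lemma crush0 z : crush 0 z = z.
Proof.
rewrite -[RHS]to_sphere_coordinate; congr to_sphere; apply/funext => i.
by rewrite /crush_vector; case: eqP => [->|_]; rewrite ?mul0r ?addr0 ?subr0 ?mul1r.
Qed.

Lemma crush_base s : 0 <= s <= 1 -> crush s (sphere_base R t) = sphere_base R t.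
Proof.
move=> s01; apply: to_sphere_base; rewrite /crush_vector.
  by rewrite eqxx coordinate_base eqxx mulr1n; lra.
by move=> i i0; rewrite (negbTE i0) [coordinate _ i]coordinate_base (negbTE i0) mulr0.
Qed.

(** At time 1 the factor of the other coordinates is the negative part of the first one, which is 0
    on this hemisphere, while the shift by 1/2 keeps the first coordinate positive. *)
Lemma crush1 z : 0 <= coordinate z ord0 -> crush 1 z = sphere_base R t.
Proof.
move=> z0; apply: to_sphere_base; rewrite /crush_vector; first by rewrite eqxx; lra.
move=> i i0; rewrite (negbTE i0) subrr mul1r add0r.
by have -> : Num.max (- coordinate z ord0) 0 = 0; [apply/max_idPr; lra | rewrite mul0r].
Qed.

(** The hemisphere will be the ball common to all petals. As it stays inside itself at all times,
    homotopies built petal by petal agree on overlaps. *)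
Lemma crush_hemisphere s z : 0 <= s <= 1 ->
  0 <= coordinate z ord0 -> 0 <= coordinate (crush s z) ord0.
Proof.
move=> s01 z0; rewrite coordinate_to_sphere ?crush_vector_neq0 // /normalize.
by apply: divr_ge0; [rewrite /crush_vector eqxx; lra | exact: sqrtr_ge0].
Qed.

Lemma crush_continuous (T : topologicalType) (s : T -> R) (f : T -> sphere_point) :
  (forall x, 0 <= s x <= 1) -> continuous s -> continuous f ->
  continuous (fun x => crush (s x) (f x)).
Proof.
move=> s01 cs cf; apply: to_sphere_continuous => [i|x]; last exact: crush_vector_neq0.
have cz j : continuous (fun x => coordinate (f x) j).
  exact: (continuous_compose cf (@coordinate_continuous j)).
rewrite /crush_vector; case: eqP => _.
  apply: continuous_fun_add => //; apply: continuous_fun_mul => //.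
  exact: continuous_fun_cst.
apply: continuous_fun_mul => //; apply: continuous_fun_add.
  apply: continuous_fun_add; first exact: continuous_fun_cst.
  exact: continuous_fun_opp.
apply: continuous_fun_mul => //; apply: continuous_fun_max; last exact: continuous_fun_cst.
exact: continuous_fun_opp.
Qed.

End Sphere.

(** * The join of a discrete set with a cross-polytope *)

Section Bouquet.
Variables (R : realType) (r t : nat).

Definition bouquet_vertex : finType := ('I_r.+2 + 'I_t * bool)%type.

(** A complete graph on [r + 2] vertices and [t] disjoint edges. The two ends of the edge [j] are
    antipodal vertices of the cross-polytope. *)
Definition bouquet_adj : rel bouquet_vertex := fun a b =>
  match a, b with
  | inl i, inl j => i != j
  | inr p, inr q => (p.1 == q.1) && (p.2 != q.2)
  | _, _ => false
  end.

Local Notation X := (stable_space R bouquet_adj).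
Local Notation S := (sphere_point R t).
Local Notation W := (wedge_of_spheres R (fun _ : 'I_r.+1 => t)).
Implicit Types (i : 'I_r.+1) (x : X) (v : 'I_t.+1 -> R).

Local Notation petal i := (inl (lift ord0 i) : bouquet_vertex).

(** The union of the balls over [inl ord0] and [petal i], a sphere of dimension [t]. The ball over
    [inl ord0] lies in every petal; it is the one to be crushed. *)
Definition on_petal i : set X :=
  [set x | forall j, j != i -> weight x (petal j) = 0].

(** On its petal, coordinate 0 is [x (inl ord0) - x (petal i)]. Elsewhere the formula folds the
    other balls onto the one over [inl ord0], so that the map is continuous on the whole complex, as
    [continuous_glue] demands of each piece. *)
Definition flatten_petal i (x : bouquet_vertex -> R) : 'I_t.+1 -> R := fun k =>
  if unlift ord0 k is Some j then x (inr (j, true)) - x (inr (j, false))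
  else x (inl ord0) + \sum_j x (petal j) - x (petal i) *+ 2.

Definition pos (a : R) : R := Num.max a 0.

Definition unflatten_petal i v : bouquet_vertex -> R := fun l =>
  match l with
  | inl a => if a == ord0 then pos (v ord0)
             else if a == lift ord0 i then pos (- v ord0) else 0
  | inr p => if p.2 then pos (v (lift ord0 p.1)) else pos (- v (lift ord0 p.1))
  end.

Lemma posB a : pos a - pos (- a) = a.
Proof. by rewrite /pos; case: (leP a 0); case: (leP (- a) 0); lra. Qed.

Lemma posD a : pos a + pos (- a) = `|a|.
Proof.
rewrite /pos; case: (leP 0 a) => a0; [rewrite ger0_norm // | rewrite ltr0_norm //];
  case: (leP a 0); case: (leP (- a) 0); lra.
Qed.

Lemma pos_ge0 a : 0 <= pos a.
Proof. by rewrite /pos le_max lexx orbT. Qed.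

Lemma pos_excl a : pos a != 0 -> pos (- a) != 0 -> False.
Proof.
by rewrite /pos; case: (leP a 0); rewrite ?eqxx //; case: (leP (- a) 0);
  rewrite ?eqxx //; lra.
Qed.

Lemma posM c a : 0 <= c -> pos (c * a) = c * pos a.
Proof. by move=> c0; rewrite /pos maxr_pMr // mulr0. Qed.

Lemma sum_bouquet (F : bouquet_vertex -> R) :
  \sum_l F l = F (inl ord0) + \sum_j F (petal j) +
    \sum_j (F (inr (j, true)) + F (inr (j, false))).
Proof.
rewrite big_sumType /= big_ord_recl; congr (_ + _).
rewrite (eq_bigr (fun p => F (inr (p.1, p.2)))); last by case.
rewrite -(pair_bigA _ (fun j b => F (inr (j, b)))) /=; apply: eq_bigr => j _.
by rewrite big_bool.
Qed.

Lemma unflatten_petal_sum i v :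
  \sum_l unflatten_petal i v l = \sum_k `|v k|.
Proof.
rewrite sum_bouquet [RHS]big_ord_recl /=; congr (_ + _).
  rewrite (bigD1 i) //= eqxx big1 ?addr0 ?posD // => j ji.
  by rewrite (inj_eq lift_inj) (negbTE ji).
by apply: eq_bigr => j _; rewrite posD.
Qed.

Lemma sum_norm_gt0 v : sqnorm v != 0 -> 0 < \sum_k `|v k|.
Proof.
move=> v0; rewrite lt_def sumr_ge0 ?andbT //; apply: contra v0.
rewrite psumr_eq0 // => /allP h; rewrite /sqnorm big1 // => k _.
by have := h k (mem_index_enum _); rewrite /= normr_eq0 => /eqP ->; rewrite expr0n.
Qed.

(** Dividing by the l1 norm projects the round sphere radially onto the boundary of the
    cross-polytope. The support is stable because the positive and the negative part of a number are
    never both nonzero. *)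
Lemma unflatten_petal_setP i (z : S) :
  realization_set R (stable_complex bouquet_adj)
    (fun l => unflatten_petal i (coordinate z) l / \sum_k `|coordinate z k|).
Proof.
have n0 : 0 < \sum_k `|coordinate z k|.
  by apply: sum_norm_gt0; rewrite sqnorm_coordinate oner_eq0.
apply/stable_setP; split.
- move=> l; apply: divr_ge0; last exact: ltW.
  by case: l => [a|[j []]] /=; [case: ifP => _; [|case: ifP => _] | |]; rewrite ?pos_ge0.
- by rewrite -mulr_suml unflatten_petal_sum mulfV // gt_eqF.
- move=> a b; rewrite !mulf_eq0 invr_eq0 (gt_eqF n0) !orbF.
  case: a b => [a|[a []]] [b|[b []]] //=.
  + case: (eqVneq a ord0) => [->|a0]; case: (eqVneq b ord0) => [_|b0]; rewrite ?eqxx //.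
    * by case: (b == _); rewrite ?eqxx // => h1 h2; case: (pos_excl h1 h2).
    * by case: (a == _); rewrite ?eqxx // => h1 h2; case: (pos_excl h2 h1).
    * by case: (eqVneq a (lift ord0 i)) => [->|_]; case: (eqVneq b (lift ord0 i)) => _;
        rewrite ?eqxx.
  + by rewrite andbF.
  + by case: (eqVneq a b) => //= -> h1 h2; case: (pos_excl h1 h2).
  + by case: (eqVneq a b) => //= -> h1 h2; case: (pos_excl h2 h1).
  + by rewrite andbF.
Qed.

Definition sphere_to_petal i (z : S) : X := to_realization (unflatten_petal_setP i z).

Definition petal_to_sphere i x : S := to_sphere (flatten_petal i (weight x)).

Lemma flatten_unflatten i v c :
  flatten_petal i (fun l => unflatten_petal i v l / c) = fun k => c^-1 * v k.
Proof.
apply/funext => k; rewrite /flatten_petal.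
case: unliftP => [j ->|->] /=; first by rewrite -mulrBl posB mulrC.
rewrite (bigD1 i) //= eqxx big1 ?addr0; last first.
  by move=> j ji; rewrite (inj_eq lift_inj) (negbTE ji) mul0r.
by rewrite -[in RHS](posB (v ord0)); ring.
Qed.

Lemma sphere_to_petalK i : cancel (sphere_to_petal i) (petal_to_sphere i).
Proof.
move=> z; rewrite /petal_to_sphere weight_to_realization flatten_unflatten.
rewrite to_sphere_scale ?to_sphere_coordinate // invr_gt0.
by apply: sum_norm_gt0; rewrite sqnorm_coordinate oner_eq0.
Qed.

Lemma flatten_petal_petal i x : on_petal i x ->
  flatten_petal i (weight x) ord0 = weight x (inl ord0) - weight x (petal i).
Proof.
move=> xi; rewrite /flatten_petal unlift_none (bigD1 i) //= big1 ?addr0.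
  by rewrite mulr2n; ring.
exact: xi.
Qed.

Lemma weight_stable x a b : bouquet_adj a b -> weight x a * weight x b = 0.
Proof.
move=> ab; have /stable_setP[_ _ xe] := weightP x.
apply/eqP; rewrite mulf_eq0; apply: contraT; rewrite negb_or => /andP[xa xb].
by have := xe _ _ xa xb; rewrite ab.
Qed.

Lemma pos_sub (a b : R) : 0 <= a -> 0 <= b -> a * b = 0 ->
  pos (a - b) = a /\ pos (- (a - b)) = b.
Proof.
move=> a0 b0 /eqP; rewrite mulf_eq0 => /orP[] /eqP ->; rewrite /pos.
  split; [apply/max_idPr; lra|rewrite sub0r opprK; apply/max_idPl; lra].
split; [rewrite subr0; apply/max_idPl; lra|apply/max_idPr; lra].
Qed.

Lemma unflatten_flatten i x : on_petal i x ->
  unflatten_petal i (flatten_petal i (weight x)) = weight x.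
Proof.
move=> xi; apply/funext => -[a|[j b]] /=; last first.
  rewrite /flatten_petal liftK.
  have [] := pos_sub (weight_ge0 x (inr (j, true))) (weight_ge0 x (inr (j, false))).
    by apply: weight_stable; rewrite /= eqxx.
  by case: b.
have [] := pos_sub (weight_ge0 x (inl ord0)) (weight_ge0 x (petal i)).
  exact: weight_stable.
rewrite -flatten_petal_petal // => -> ->.
case: (unliftP ord0 a) => [j ->|->]; last by rewrite eqxx.
rewrite eq_sym (negbTE (neq_lift _ _)) (inj_eq lift_inj).
by case: eqVneq => [->//|/xi].
Qed.

(** If all differences of antipodal weights vanish, so do these weights, as one in each pair is 0.
    The mass then sits on a single vertex of the clique, and coordinate 0 is 1 or -1. *)
Lemma flatten_petal_neq0 i x : sqnorm (flatten_petal i (weight x)) != 0.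
Proof.
apply/eqP => /sqnorm_eq0 h; have := weight_sum x; rewrite sum_bouquet.
have {}hj j b : weight x (inr (j, b)) = 0.
  have := h (lift ord0 j); rewrite /flatten_petal liftK => /eqP.
  rewrite subr_eq0 => /eqP e; have := @weight_stable x (inr (j, true)) (inr (j, false)).
  rewrite /= eqxx => /(_ isT); rewrite e => /eqP; rewrite mulf_eq0 orbb => /eqP e0.
  by case: b => //; rewrite e.
rewrite [X in _ + X]big1 ?addr0 => [|j _]; last by rewrite !hj addr0.
have := h ord0; rewrite /flatten_petal unlift_none => /eqP; rewrite subr_eq0 => /eqP e.
rewrite e => xi1; suff xi0 : weight x (petal i) = 0.
  by move: xi1; rewrite xi0 mul0rn => /eqP; rewrite eq_sym oner_eq0.
apply/eqP; apply: contraT => xi.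
have z a : bouquet_adj (petal i) a -> weight x a = 0.
  by move/(weight_stable x)/eqP; rewrite mulf_eq0 (negbTE xi) => /eqP.
move: e; rewrite z /= ?add0r; last by [].
rewrite (bigD1 i) //= big1 ?addr0; last first.
  by move=> j ji; rewrite z //= (inj_eq lift_inj) eq_sym.
by rewrite mulr2n -[LHS]addr0 => /addrI e; rewrite -e eqxx in xi.
Qed.

Lemma petal_to_sphereK i x : on_petal i x ->
  sphere_to_petal i (petal_to_sphere i x) = x.
Proof.
move=> xi; apply: weight_inj; rewrite weight_to_realization.
have n0 := flatten_petal_neq0 i x; set v := flatten_petal i (weight x) in n0 *.
have c0 : 0 < (Num.sqrt (sqnorm v))^-1.
  by rewrite invr_gt0 sqrtr_gt0 lt_def n0 sqnorm_ge0.
have cE : coordinate (petal_to_sphere i x) =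
    fun k => (Num.sqrt (sqnorm v))^-1 * v k.
  by apply/funext => k; rewrite coordinate_to_sphere // /normalize mulrC.
have sE : unflatten_petal i (coordinate (petal_to_sphere i x)) =
    fun l => (Num.sqrt (sqnorm v))^-1 * weight x l.
  rewrite -(unflatten_flatten xi) cE; apply/funext => -[a|[j b]] /=; last first.
    by rewrite -!mulrN !posM ?ltW //; case: b.
  by rewrite -!mulrN !posM ?ltW //; do 2 case: ifP => _ //; rewrite mulr0.
(* The total weight being 1, the scalar left by the normalization is exactly the l1 norm, and it
   cancels. *)
rewrite -(unflatten_petal_sum i) sE -mulr_sumr weight_sum mulr1.
by apply/funext => l; rewrite mulrAC mulfV ?mul1r // gt_eqF.
Qed.

Lemma petal_to_sphere_continuous i : continuous (petal_to_sphere i).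
Proof.
have cw l := @weight_continuous R _ (stable_complex bouquet_adj) l.
apply: to_sphere_continuous => [k|x]; last exact: flatten_petal_neq0.
rewrite /flatten_petal; case: unliftP => [j _|_]; apply: continuous_fun_add => //.
- exact: continuous_fun_opp.
- by apply: continuous_fun_add => //; exact: continuous_fun_sum.
- apply: continuous_fun_opp.
  by under [X in continuous X]eq_fun do rewrite mulr2n; exact: continuous_fun_add.
Qed.

Lemma sphere_to_petal_continuous i : continuous (sphere_to_petal i).
Proof.
have cz k := @coordinate_continuous R t k.
have cpos (f : S -> R) : continuous f -> continuous (fun z => pos (f z)).
  by move=> cf; apply: continuous_fun_max => //; exact: continuous_fun_cst.
have cposN (f : S -> R) : continuous f -> continuous (fun z => pos (- f z)).
  by move=> cf; apply: cpos; exact: continuous_fun_opp.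
apply: realization_continuous => l.
under [X in continuous X]eq_fun do rewrite weight_to_realization.
apply: continuous_fun_mul.
  case: l => [a|[j []]] /=; [|exact: cpos|exact: cposN].
  case: (a == ord0); first exact: cpos.
  by case: (a == _); [exact: cposN | exact: continuous_fun_cst].
apply: continuous_fun_inv => [z|].
  by rewrite gt_eqF // sum_norm_gt0 // sqnorm_coordinate oner_eq0.
by apply: continuous_fun_sum => k; exact: continuous_fun_norm.
Qed.

(** The index enters only through the weight of [petal i], a negative part that is 0 here. In
    particular the petals agree at the base point, so they define a map out of the wedge. *)
Lemma sphere_to_petal_hemisphere i j (z : S) :
  0 <= coordinate z ord0 -> sphere_to_petal i z = sphere_to_petal j z.
Proof.
move=> z0; apply: weight_inj; rewrite !weight_to_realization.
apply/funext => -[a|p] //=; congr (_ / _).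
have -> : pos (- coordinate z ord0) = 0 by apply/max_idPr; lra.
by do 3 case: ifP => _ //.
Qed.

Lemma sphere_to_petal_on i (z : S) : on_petal i (sphere_to_petal i z).
Proof.
move=> j ji; rewrite weight_to_realization /=.
by rewrite (inj_eq lift_inj) (negbTE ji) mul0r.
Qed.

(** A point on two petals has no weight at any petal vertex, hence lies in the common ball. *)
Lemma on_petal2 i j x : on_petal i x -> on_petal j x -> i != j ->
  petal_to_sphere i x = petal_to_sphere j x /\ 0 <= coordinate (petal_to_sphere i x) ord0.
Proof.
move=> xi xj ij.
have z k : weight x (petal k) = 0.
  by have [->|/xi//] := eqVneq k i; exact: xj.
split.
  by rewrite /petal_to_sphere; congr to_sphere; apply/funext => k;
    rewrite /flatten_petal !z.
rewrite coordinate_to_sphere ?flatten_petal_neq0 //; apply: divr_ge0; last exact: sqrtr_ge0.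
by rewrite flatten_petal_petal // z subr0 weight_ge0.
Qed.

(** If no petal vertex has weight, the point lies on every petal, so the default [ord0] is as good
    as any index. *)
Definition petal_of x : 'I_r.+1 :=
  odflt ord0 [pick i | weight x (petal i) != 0].

Lemma petal_ofP x : on_petal (petal_of x) x.
Proof.
rewrite /petal_of; case: pickP => [i xi|x0] j ji /=; last by have /negbFE/eqP := x0 j.
have /eqP : weight x (petal i) * weight x (petal j) = 0.
  by apply: weight_stable; rewrite /= (inj_eq lift_inj) eq_sym.
by rewrite mulf_eq0 (negbTE xi) => /eqP.
Qed.

Lemma closed_on_petal i : closed (on_petal i).
Proof.
rewrite (_ : on_petal i =
    \bigcap_(j in [set j | j != i]) ((fun x => weight x (petal j)) @^-1` [set 0])).
  apply: closed_bigI => j _; apply: preimage_closed.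
    by move=> x _; exact: weight_continuous.
  exact: closed_eq.
by apply/seteqP; split => x.
Qed.

(** [f] reads a point in the sphere of its petal, crushes the common hemisphere and lands in the
    matching summand; [g] puts each sphere back on its petal. On each petal or sphere both
    composites become [crush 1], which [crush] deforms to the identity. *)
Theorem bouquet_equivalent : homotopy_equivalent R X W.
Proof.
pose lift_ i : S -> W := @wedge_lift _ _ (fun i : 'I_r.+1 => sphere_base R t) i.
have lift_base i j : lift_ i (sphere_base R t) = lift_ j (sphere_base R t).
  exact: (wedge_liftE (fun=> sphere_base R t) (sphere_base R t) (sphere_base R t)).
pose f x : W := lift_ (petal_of x) (crush 1 (petal_to_sphere (petal_of x) x)).
have s01 : 0 <= (1 : R) <= 1 by rewrite ler01 lexx.
have fE i x : on_petal i x -> f x = lift_ i (crush 1 (petal_to_sphere i x)).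
  move=> xi; rewrite /f; have [<-//|ne] := eqVneq (petal_of x) i.
  have [e z0] := on_petal2 (@petal_ofP x) xi ne.
  by rewrite -e crush1 //; exact: lift_base.
pose g : W -> X := wedge_fun sphere_to_petal.
have gbase i j : sphere_to_petal i (sphere_base R t) = sphere_to_petal j (sphere_base R t).
  by apply: sphere_to_petal_hemisphere; rewrite coordinate_base ler0n.
have gE i z : g (lift_ i z) = sphere_to_petal i z by exact: wedge_lift_funE.
have clift i : continuous (lift_ i).
  by move=> z; exact: (@wedge_lift_continuous _ _ (fun=> sphere_base R t) i z).
exists f, g; split.
- apply: (@continuous_glue _ _ _ on_petal
    (fun i x => lift_ i (crush 1 (petal_to_sphere i x)))) => //.
  + exact: closed_on_petal.
  + move=> i; apply: continuous_compose => //; apply: crush_continuous => //.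
      exact: continuous_fun_cst.
    exact: petal_to_sphere_continuous.
  + by move=> x; exists (petal_of x); exact: petal_ofP.
- by apply: wedge_fun_continuous => // i; exact: sphere_to_petal_continuous.
- apply: homotopic_sym.
  pose F i (p : X * R) := sphere_to_petal i (crush (clamp p.2) (petal_to_sphere i p.1)).
  apply: (@homotopic_of_continuous _ _ _ _ _ (fun p => F (petal_of p.1) p)).
  + apply: (@continuous_glue _ _ _ (fun i => fst @^-1` on_petal i) F) => //.
    * move=> i; apply: preimage_closed; first by move=> p _; exact: cvg_fst.
      exact: closed_on_petal.
    * move=> i; apply: continuous_compose; last exact: sphere_to_petal_continuous.
      apply: crush_continuous => [p||]; first exact: clamp_itv.
        exact: (continuous_compose (@continuous_snd _ _) (@clamp_continuous R)).
      exact: (continuous_compose (@continuous_fst _ _) (petal_to_sphere_continuous (i := i))).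
    * by move=> p; exists (petal_of p.1); exact: petal_ofP.
    * move=> i [x s] /= xi; rewrite /F /=; have [<-//|ne] := eqVneq (petal_of x) i.
      have [e z0] := on_petal2 (@petal_ofP x) xi ne.
      rewrite -e; apply: sphere_to_petal_hemisphere; apply: crush_hemisphere => //.
      exact: clamp_itv.
  + by move=> x; rewrite /F /= clamp0 crush0 petal_to_sphereK //; exact: petal_ofP.
  + by move=> x; rewrite /F /= clamp1 gE.
- apply: homotopic_sym.
  pose k (i : 'I_r.+1) (s : R) (z : S) : W := lift_ i (crush (clamp s) z).
  have kE s i j : k i s (sphere_base R t) = k j s (sphere_base R t).
    by rewrite /k !crush_base ?clamp_itv //; exact: lift_base.
  (* Continuity on the product with the time line is obtained from [wedge_fun_joint_continuous],
     applied to finitely many spheres with closed base points. It takes the time first, hence the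
     later swap. *)
  pose H := uncurry (fun s => wedge_fun (fun i => k i s)) : R * W -> W.
  have cH : continuous H.
    apply: wedge_fun_joint_continuous => //.
    * exact: finite_finset.
    * by move=> i; exact: closed_sphere_base.
    * move=> i; rewrite (_ : uncurry _ = fun p : R * S => lift_ i (crush (clamp p.1) p.2)).
        apply: continuous_compose => //; apply: crush_continuous => [p||].
        - exact: clamp_itv.
        - exact: (continuous_compose (@continuous_fst _ _) (@clamp_continuous R)).
        - exact: continuous_snd.
      by apply/funext => -[].
  have HE s i z : H (s, lift_ i z) = lift_ i (crush (clamp s) z).
    by rewrite /H /uncurry /=; apply: wedge_lift_funE.
  have Wlift (w : W) : exists i z, w = lift_ i z.
    have : [set: W] w by [].
    rewrite -(@wedgeTE _ _ (fun i : 'I_r.+1 => sphere_base R t)).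
    by case=> i _ [z _ <-]; exists i, z.
  apply: (@homotopic_of_continuous _ _ _ _ _ (fun p => H (p.2, p.1))).
  + apply: (continuous_compose (f := fun p : W * R => (p.2, p.1))) => //.
    by apply: continuous_pair; [exact: continuous_snd | exact: continuous_fst].
  + by move=> w; have [i [z ->]] := Wlift w;
    rewrite -[LHS]/(H (0, lift_ i z)) HE clamp0 crush0.
  + move=> w; have [i [z ->]] := Wlift w.
    rewrite -[LHS]/(H (1, lift_ i z)) HE clamp1 /= gE.
    by rewrite (fE i) ?sphere_to_petalK //; exact: sphere_to_petal_on.
Qed.

End Bouquet.

(** * Reductions of graphs *)

Section Good.
Variable R : realType.

Definition bouquet_or_point (X : topologicalType) :=
  contractible R X \/ exists (r : nat) (d : 'I_r.+1 -> nat),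
    homotopy_equivalent R X (wedge_of_spheres R d).

Lemma bouquet_or_point_equivalent (X Y : topologicalType) :
  homotopy_equivalent R X Y -> bouquet_or_point Y -> bouquet_or_point X.
Proof.
move=> XY [cY|[r [d YW]]]; first by left; exact: contractible_homotopy_equivalent cY.
by right; exists r, d; exact: homotopy_equivalent_trans YW.
Qed.

Section Graph.
Variable V : finType.
Implicit Types (e : rel V) (L : seq V) (E X D : seq (V * V)) (a b u v w : V).

Definition good e := bouquet_or_point (stable_space R e).

Lemma good_add_edge e u v w :
  symmetric e -> w != u -> w != v -> ~~ e w w -> ~~ e w u -> ~~ e w v ->
  (forall y, e w y -> e u y || e v y) ->
  good e <-> good (add_edge e u v).
Proof.
move=> es wu wv ww ewu ewv nw.
have h := add_edge_equivalent R es wu wv ww ewu ewv nw.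
split; apply: bouquet_or_point_equivalent => //; exact: homotopy_equivalent_sym.
Qed.

(** Vertices with loops belong to no stable set, so the relation may be changed freely at them as
    long as the loops remain. *)
Lemma good_stable e e' : stable e =1 stable e' -> good e' -> good e.
Proof.
move=> ee'; rewrite /good /stable_space.
suff -> : stable_complex e = stable_complex e' by [].
rewrite /stable_complex; move: (@stable_sub V e) (@stable_sub V e').
have -> : [set S | stable e S]%SET = [set S | stable e' S]%SET.
  by apply/setP => S; rewrite !inE ee'.
by move=> p q; congr SComplex; exact: Prop_irrelevance.
Qed.

Definition adjacent E a b := ((a, b) \in E) || ((b, a) \in E).

Lemma adjacent_sym E : symmetric (adjacent E).
Proof. by move=> a b; rewrite /adjacent orbC. Qed.

Lemma adjacent_cat E E' a b :
  adjacent (E ++ E') a b = adjacent E a b || adjacent E' a b.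
Proof. by rewrite /adjacent !mem_cat orbACA. Qed.

Lemma adjacent_cons u v E a b :
  adjacent ((u, v) :: E) a b =
  [|| (a == u) && (b == v), (a == v) && (b == u) | adjacent E a b].
Proof.
rewrite /adjacent !inE !xpair_eqE [(b == u) && _]andbC.
by case: (_ && _); case: (_ && _); case: (_ \in _) => //=; rewrite ?orbT.
Qed.

Lemma adjacent_nil a b : adjacent [::] a b = false.
Proof. by []. Qed.

(** A vertex outside [L] is joined to everything, itself included. Two graphs on the same [L] thus
    coincide once their edges inside [L] do, and edges at deleted vertices may stay listed in
    [E]. *)
Definition graph L E : rel V :=
  fun a b => [|| a \notin L, b \notin L | adjacent E a b].

Lemma graph_sym L E : symmetric (graph L E).
Proof.
by move=> a b; rewrite /graph adjacent_sym; case: (a \in L); case: (b \in L).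
Qed.

Lemma good_graph_eq L L' E E' : L =i L' ->
  {in L &, forall a b, adjacent E a b = adjacent E' a b} ->
  good (graph L' E') -> good (graph L E).
Proof.
move=> LL' EE'; apply: good_stable => S.
have h a b : graph L E a b = graph L' E' a b.
  rewrite /graph -!LL'; case: (boolP (a \in L)) => //= aL.
  by case: (boolP (b \in L)) => //= bL; exact: EE'.
by apply/stableP/stableP => hS x y xS yS; [rewrite -h | rewrite h]; exact: hS.
Qed.

(** This is the edge from [y] to itself. The relation so obtained and the graph on the filtered list
    differ only at pairs involving [y], which has a loop in both. *)
Lemma good_delete L E w y :
  w \in L -> y \in L -> w != y -> ~~ adjacent E w w -> ~~ adjacent E w y ->
  {in L, forall z, adjacent E w z -> adjacent E y z} ->
  good (graph [seq z <- L | z != y] E) -> good (graph L E).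
Proof.
move=> wL yL wy eww ewy nw gd.
apply/(good_add_edge (u := y) (v := y) (w := w) (@graph_sym L E)) => //.
- by rewrite /graph wL.
- by rewrite /graph wL yL.
- by rewrite /graph wL yL.
- move=> z; rewrite /graph wL yL /= orbb; case: (boolP (z \in L)) => //= zL.
  exact: nw.
- apply: good_stable gd => S; apply/stableP/stableP => hS a b aS bS.
  + have la c : c \in S -> (c \in L) && (c != y).
      move=> cS; have := hS c c cS cS; rewrite /add_edge /graph orbb.
      by case: (c \in L) => //=; case: eqP => //=; rewrite orbT.
    have := hS a b aS bS; have := la a aS; have := la b bS.
    rewrite /add_edge /graph !mem_filter.
    by case: eqP; case: eqP; case: (a \in L); case: (b \in L); rewrite //= orbF.
  + have := hS a b aS bS; rewrite /add_edge /graph !mem_filter.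
    by case: eqP; case: eqP; case: (a \in L); case: (b \in L); rewrite //= orbF.
Qed.

(** The equivalence serves in both directions: in [good_cycle] one edge is added and another
    removed. *)
Lemma good_edge L E E' u v w :
  u \in L -> v \in L -> w \in L -> w != u -> w != v ->
  ~~ adjacent E w w -> ~~ adjacent E w u -> ~~ adjacent E w v ->
  {in L, forall z, adjacent E w z -> adjacent E u z || adjacent E v z} ->
  adjacent E' =2 adjacent ((u, v) :: E) ->
  good (graph L E) <-> good (graph L E').
Proof.
move=> uL vL wL wu wv ww ewu ewv nw E'E.
have -> : graph L E' = add_edge (graph L E) u v.
  apply/funext => a; apply/funext => b; rewrite /graph /add_edge E'E adjacent_cons.
  case: (boolP (a \in L)) => //=; case: (boolP (b \in L)) => //= _ _.
  by rewrite orbA orbC.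
apply: (good_add_edge (w := w) (@graph_sym L E)) => //.
- by rewrite /graph wL.
- by rewrite /graph wL uL.
- by rewrite /graph wL vL.
- move=> z; rewrite /graph wL uL vL /=; case: (boolP (z \in L)) => //= zL.
  exact: nw.
Qed.

Definition steps (s : seq V) : seq (V * V) := zip s (behead s).

Lemma steps_cons2 a b s : steps (a :: b :: s) = (a, b) :: steps (b :: s).
Proof. by []. Qed.

Lemma steps_mem a b s : (a, b) \in steps s -> (a \in s) && (b \in s).
Proof.
elim: s => [|x [|y s] IH] //; rewrite steps_cons2 in_cons xpair_eqE.
case/orP => [/andP[/eqP-> /eqP->]|/IH /andP[ha hb]]; first by rewrite !inE !eqxx orbT.
by rewrite in_cons ha in_cons hb !orbT.
Qed.

Lemma adjacent_steps_notin a b s : a \notin s -> adjacent (steps s) a b = false.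
Proof.
by move=> /negbTE as'; apply/negP => /orP[] /steps_mem; rewrite as' ?andbF.
Qed.

Lemma adjacent_steps_cons x s a b : a != x -> b != x ->
  adjacent (steps (x :: s)) a b = adjacent (steps s) a b.
Proof.
move=> /negbTE ax /negbTE bx; case: s => [|y s] //.
by rewrite steps_cons2 adjacent_cons ax bx andbF.
Qed.

Lemma adjacent_steps_rcons2 s y x a b :
  adjacent (steps (rcons (rcons s y) x)) a b =
  adjacent (steps (rcons s y)) a b || adjacent [:: (y, x)] a b.
Proof.
elim: s => [|z [|z' s] IH] //.
  by rewrite /= /steps /= !adjacent_cons !adjacent_nil !orbF orbA.
by rewrite !rcons_cons in IH *; rewrite !steps_cons2 !(adjacent_cons z z') IH !orbA.
Qed.

Lemma adjacent_steps_rev s a b : adjacent (steps (rev s)) a b = adjacent (steps s) a b.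
Proof.
elim: s => [|x [|y s] IH] //.
rewrite !rev_cons adjacent_steps_rcons2 -rev_cons IH steps_cons2 !adjacent_cons.
rewrite adjacent_nil orbF; case: (adjacent _ _ _); first by rewrite !orbT.
by rewrite /= orbF orbC.
Qed.

Lemma adjacent_steps_rcons x s a b : a != x -> b != x ->
  adjacent (steps (rcons s x)) a b = adjacent (steps s) a b.
Proof.
move=> ax bx; rewrite -adjacent_steps_rev rev_rcons adjacent_steps_cons //.
exact: adjacent_steps_rev.
Qed.

(* The disjoint union of the edges in [D] and the paths in [ps], with the
   edges in [X] added. *)
Definition live D (ps : seq (seq V)) := unzip1 D ++ unzip2 D ++ flatten ps.

Definition edges D (ps : seq (seq V)) X := D ++ flatten (map steps ps) ++ X.

Definition paths D ps X : rel V := graph (live D ps) (edges D ps X).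

Lemma adjacent_unzip D a b : adjacent D a b -> (a \in unzip1 D ++ unzip2 D).
Proof.
rewrite mem_cat => /orP[] h; apply/orP; [left|right].
  by apply/mapP; exists (a, b).
by apply/mapP; exists (b, a).
Qed.

Lemma adjacent_flatten_steps ps a b :
  adjacent (flatten (map steps ps)) a b -> a \in flatten ps.
Proof.
move=> h; have {h} : (a \in flatten ps) && (b \in flatten ps).
  case/orP: h => /flatten_mapP[s sps /steps_mem /andP[h1 h2]]; apply/andP;
    by split; apply/flattenP; exists s.
by case/andP.
Qed.

Lemma adjacent_edges D s ps X a b :
  adjacent (edges D (s :: ps) X) a b =
  [|| adjacent D a b, adjacent (steps s) a b,
      adjacent (flatten (map steps ps)) a b | adjacent X a b].
Proof. by rewrite /edges /= -catA !adjacent_cat. Qed.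

Lemma adjacent_edges_in D s ps X a b : uniq (live D (s :: ps)) -> a \in s ->
  adjacent (edges D (s :: ps) X) a b = adjacent (steps s) a b || adjacent X a b.
Proof.
move=> U as'; rewrite adjacent_edges.
have /negbTE -> : ~~ adjacent D a b.
  apply/negP => /adjacent_unzip aD; move: U; rewrite /live catA cat_uniq.
  case/and3P=> _ /hasP h _; apply: h; exists a => //=.
  by rewrite mem_cat as'.
have /negbTE -> // : ~~ adjacent (flatten [seq steps i | i <- ps]) a b.
apply/negP => /adjacent_flatten_steps aps; move: U; rewrite /live catA cat_uniq.
case/and3P=> _ _; rewrite /= cat_uniq => /and3P[_ /hasP h _]; apply: h.
by exists a.
Qed.

End Graph.
End Good.

Local Ltac count_solve :=
  apply/permP => p; rewrite /live /=;
  do 5 rewrite /= ?cats0 -?cats1 ?count_cat ?count_rev; clear; lia.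

(** * Paths and cycles, three vertices at a time *)

Section Reductions.
Variables (R : realType) (V : finType).
Implicit Types (e : rel V) (L s q : seq V) (ps : seq (seq V)).
Implicit Types (E X D : seq (V * V)) (a b c d u v w : V).

Definition avoids a X := all (fun p => (p.1 != a) && (p.2 != a)) X.

Lemma adjacent_avoids a X b : avoids a X -> adjacent X a b = false.
Proof.
move=> /allP h; apply/negP => /orP[] /h /andP[/=]; first by rewrite eqxx.
by rewrite eqxx.
Qed.

Lemma uniq_live D s ps : uniq (live D (s :: ps)) ->
  [/\ uniq s, {in s, forall x, x \notin flatten ps} &
      {in s, forall x, (x \notin unzip1 D) && (x \notin unzip2 D)}].
Proof.
rewrite /live catA cat_uniq => /and3P[_ /hasPn h1].
rewrite /= cat_uniq => /and3P[us /hasPn h2 _]; split => //.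
  by move=> x xs; apply/negP => /h2; rewrite /= xs.
by move=> x xs; have := h1 x; rewrite /= !mem_cat xs => /(_ isT); rewrite negb_or.
Qed.

Lemma good_delete_perm L L' E E' w y : uniq L -> perm_eq L (y :: L') -> w \in L' ->
  ~~ adjacent E w w -> ~~ adjacent E w y ->
  {in L', forall z, adjacent E w z -> adjacent E y z} ->
  (forall x z, x != y -> z != y -> adjacent E x z = adjacent E' x z) ->
  good R (graph L' E') -> good R (graph L E).
Proof.
move=> U pL wL' ww wy nw EE' gd.
have yL' : y \notin L' by move: U; rewrite (perm_uniq pL) => /andP[].
apply: (@good_delete _ _ _ _ w y) => //.
- by rewrite (perm_mem pL) inE wL' orbT.
- by rewrite (perm_mem pL) mem_head.
- by apply/eqP => e; rewrite -e wL' in yL'.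
- move=> z; rewrite (perm_mem pL) inE => /predU1P[->|]; last exact: nw.
  by rewrite (negbTE wy).
- apply: good_graph_eq gd => [x|x z]; last first.
    by rewrite !mem_filter => /andP[xy _] /andP[zy _]; exact: EE'.
  rewrite mem_filter (perm_mem pL) inE.
  by case: eqVneq => [->|] //=; rewrite (negbTE yL').
Qed.

(** The only neighbour of the end [a] is [b], which is also a neighbour of [c]. So [c] can be
    deleted, which detaches [ab] from the rest of the path; edges of [X] at [c] stay listed but
    become void. *)
Lemma path_reduce D a b c s ps X :
  uniq (live D ((a :: b :: c :: s) :: ps)) -> avoids a X ->
  good R (paths ((a, b) :: D) (s :: ps) X) ->
  good R (paths D ((a :: b :: c :: s) :: ps) X).
Proof.
move=> U aX gd; have [us ups uD] := uniq_live U.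
have := us; rewrite /= !inE !negb_or => /and4P[/and3P[ab ac as'] /andP[bc bs] cs us'].
have adja z : adjacent (edges D ((a :: b :: c :: s) :: ps) X) a z = (z == b).
  rewrite adjacent_edges_in // ?mem_head // (adjacent_avoids z aX) orbF.
  rewrite !steps_cons2 !adjacent_cons eqxx (negbTE ab) (negbTE ac) /=.
  by rewrite adjacent_steps_notin ?orbF // inE negb_or ac.
have inL x : x \in a :: b :: c :: s -> x \in live D ((a :: b :: c :: s) :: ps).
  by move=> xs; rewrite !mem_cat xs !orbT.
apply: (@good_delete_perm _ (live ((a, b) :: D) (s :: ps)) _
  (edges ((a, b) :: D) (s :: ps) X) a c) => //.
- by count_solve.
- by rewrite mem_head.
- by rewrite adja.
- by rewrite adja eq_sym.
- move=> z _; rewrite adja => /eqP ->; rewrite adjacent_edges_in //.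
    by rewrite !steps_cons2 !adjacent_cons !eqxx !orbT.
  by rewrite !inE eqxx !orbT.
move=> x z xc zc.
rewrite !adjacent_edges adjacent_cons !steps_cons2 !adjacent_cons.
rewrite (negbTE xc) (negbTE zc) andbF adjacent_steps_cons //=.
by case: (adjacent D x z); rewrite /= ?orbT ?orbF -?orbA.
Qed.

Lemma uniq_live_reduce D a b c s ps : uniq (live D ((a :: b :: c :: s) :: ps)) ->
  uniq (live ((a, b) :: D) (s :: ps)).
Proof.
move=> U; suff : uniq (c :: live ((a, b) :: D) (s :: ps)) by case/andP.
by apply: (etrans (perm_uniq _)) U; count_solve.
Qed.

Lemma path_isolated D a ps :
  uniq (live D ([:: a] :: ps)) -> good R (paths D ([:: a] :: ps) [::]).
Proof.
move=> U; left; have aL : a \in live D ([:: a] :: ps).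
  by rewrite !mem_cat mem_head !orbT.
have h y : y \in live D ([:: a] :: ps) -> ~~ paths D ([:: a] :: ps) [::] a y.
  by move=> yL; rewrite /paths /graph aL yL /= adjacent_edges_in ?mem_head.
apply: (@isolated_contractible _ _ _ a); first exact: h.
move=> y; rewrite {1}/paths {1}/graph orbA orbb; case: (boolP (y \in _)) => //= yL _.
by rewrite [_ y a]graph_sym andbb; exact: h.
Qed.

Lemma good_clique D L e : uniq (unzip1 D ++ unzip2 D ++ L) -> (1 < size L)%N ->
  {in unzip1 D ++ unzip2 D ++ L &, forall a b,
    e a b = [&& a \in L, b \in L & a != b] || adjacent D a b} ->
  (forall v, v \notin unzip1 D ++ unzip2 D ++ L -> e v v) ->
  good R e.
Proof.
case: L => [|x0 [|x1 L]] // U _ eE dead; set A := x0 :: x1 :: L in U eE dead *.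
pose i (l : bouquet_vertex (size L) (size D)) : V :=
  match l with
  | inl k => nth x0 A k
  | inr p => nth x0 (if p.2 then unzip1 D else unzip2 D) p.1
  end.
move: U; rewrite cat_uniq cat_uniq => /and3P[u1 /hasPn h1 /and3P[u2 /hasPn h2 uA]].
have sA : size A = (size L).+2 by [].
have inA k : i (inl k) \in A by rewrite mem_nth.
have in1 k : i (inr (k, true)) \in unzip1 D by rewrite mem_nth // size_map.
have in2 k : i (inr (k, false)) \in unzip2 D by rewrite mem_nth // size_map.
have d12 x : x \in unzip1 D -> x \notin unzip2 D.
  move=> x1D; apply/negP => x2; have := h1 x.
  by rewrite mem_cat x2 => /(_ isT); rewrite /= x1D.
have d1A x : x \in unzip1 D -> x \notin A.
  move=> x1D; apply/negP => x2; have := h1 x.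
  by rewrite mem_cat x2 orbT => /(_ isT); rewrite /= x1D.
have d2A x : x \in unzip2 D -> x \notin A.
  by move=> x1D; apply/negP => x2; have := h2 x x2; rewrite /= x1D.
have iL l : i l \in unzip1 D ++ unzip2 D ++ A.
  rewrite !mem_cat; case: l => [k|[k []]]; first by rewrite inA !orbT.
    by rewrite in1.
  by rewrite in2 orbT.
have injA k k' : (i (inl k) == i (inl k')) = (k == k').
  by rewrite /i nth_uniq.
have inj1 k k' : (i (inr (k, true)) == i (inr (k', true))) = (k == k').
  by rewrite /i /= nth_uniq // size_map.
have inj2 k k' : (i (inr (k, false)) == i (inr (k', false))) = (k == k').
  by rewrite /i /= nth_uniq // size_map.
have pairD k k' : ((i (inr (k, true)), i (inr (k', false))) \in D) = (k == k').
  apply/idP/eqP => [/(nthP (x0, x0))[j jD jE]|->].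
    have e1 : i (inr (Ordinal jD, true)) == i (inr (k, true)).
      by rewrite /i /= (nth_map (x0, x0)) // jE.
    have e2 : i (inr (Ordinal jD, false)) == i (inr (k', false)).
      by rewrite /i /= (nth_map (x0, x0)) // jE.
    by move: e1 e2; rewrite inj1 inj2 => /eqP <- /eqP <-.
  have -> : (i (inr (k', true)), i (inr (k', false))) = nth (x0, x0) D k'.
    by rewrite /i /= !(nth_map (x0, x0)) // -surjective_pairing.
  exact: mem_nth.
have Dmem x y : (x, y) \in D -> x \in unzip1 D /\ y \in unzip2 D.
  by move=> h; split; apply/mapP; exists (x, y).
(* [L] now denotes the clique without two of its vertices, so [size L] is the [r] of the [r + 2]
   points. *)
right; exists (size L), (fun=> size D).
apply: homotopy_equivalent_trans (bouquet_equivalent R (size L) (size D)).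
apply: (@stable_space_iso _ _ _ _ _ i).
- move=> [k|[k []]] [k'|[k' []]] /eqP.
  + by rewrite injA => /eqP ->.
  + by move=> /eqP h; have := d1A _ (in1 k'); rewrite -h inA.
  + by move=> /eqP h; have := d2A _ (in2 k'); rewrite -h inA.
  + by move=> /eqP h; have := d1A _ (in1 k); rewrite h inA.
  + by rewrite inj1 => /eqP ->.
  + by move=> /eqP h; have := d12 _ (in1 k); rewrite h in2.
  + by move=> /eqP h; have := d2A _ (in2 k); rewrite h inA.
  + by move=> /eqP h; have := d12 _ (in1 k'); rewrite -h in2.
  + by rewrite inj2 => /eqP ->.
- move=> v ev; have : v \in unzip1 D ++ unzip2 D ++ A by apply: contraNT ev; exact: dead.
  rewrite !mem_cat => /or3P[] /(nthP x0)[j jD <-]; apply/codomP.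
  + by rewrite size_map in jD; exists (inr (Ordinal jD, true)).
  + by rewrite size_map in jD; exists (inr (Ordinal jD, false)).
  + by exists (inl (Ordinal jD)).
- have nA1 k : (i (inr (k, true)) \in A) = false by exact/negbTE/d1A.
  have nA2 k : (i (inr (k, false)) \in A) = false by exact/negbTE/d2A.
  have DAl k y : ((i (inl k), y) \in D) = false.
    by apply/negP => /Dmem[/d1A]; rewrite inA.
  have DAr k y : ((y, i (inl k)) \in D) = false.
    by apply/negP => /Dmem[_ /d2A]; rewrite inA.
  have D1 k y : ((y, i (inr (k, true))) \in D) = false.
    by apply/negP => /Dmem[_ h]; have := d12 _ (in1 k); rewrite h.
  have D2 k y : ((i (inr (k, false)), y) \in D) = false.
    by apply/negP => /Dmem[h _]; have := d12 _ h; rewrite in2.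
  move=> l l'; rewrite eE ?iL // /adjacent.
  case: l l' => [k|[k []]] [k'|[k' []]];
    rewrite ?inA ?nA1 ?nA2 ?DAl ?DAr ?D1 ?D2 ?pairD ?injA ?andbF ?orbF //=;
    rewrite ?andbF ?andbT //.
Qed.

(** Modulo 3, a path with remainder 0 disappears, with remainder 2 it leaves one more edge for [D],
    and with remainder 1 an isolated vertex, hence a cone. The last hypothesis excludes the empty
    complex. *)
Lemma good_paths D ps : uniq (live D ps) -> unzip1 D ++ flatten ps != [::] ->
  good R (paths D ps [::]).
Proof.
elim: ps D => [|s ps IH] D.
  (* When only edges are left, one of them serves as a clique of two points: the result is a single
     sphere. *)
  case: D => [|[a b] D] // U _; apply: (@good_clique D [:: a; b]) => //.
  - apply: (etrans (perm_uniq _)) U; rewrite /live cats0 /=.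
    by count_solve.
  - move=> x y xL yL.
    have live_eq : live ((a, b) :: D) [::] =i unzip1 D ++ unzip2 D ++ [:: a; b].
      by apply: perm_mem; count_solve.
    rewrite /paths /graph !live_eq xL yL /edges /= cats0 adjacent_cons.
    have ab : a != b.
      by move: U; rewrite /live cats0 /= mem_cat !inE !negb_or => /andP[/andP[_ /andP[]]].
    case: (adjacent D x y); rewrite ?orbT ?orbF // !inE.
    move/eqP: ab => ab; case: (x =P a); case: (x =P b); case: (y =P a); case: (y =P b);
      by case: (x =P y) => //= *; exfalso; congruence.
  - move=> v vL; rewrite /paths /graph.
    by rewrite (perm_mem (_ : perm_eq _ (unzip1 D ++ unzip2 D ++ [:: a; b]))) ?vL //;
      count_solve.
have [n] := ubnP (size s); elim: n s D => // n IHn [|a [|b [|c s]]] D.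
- by move=> _; exact: IH.
- by move=> _ U _; exact: path_isolated.
- move=> _ U _; have {}IH := IH ((a, b) :: D) _ isT.
  apply: good_graph_eq (IH _).
  + by apply: perm_mem; count_solve.
  + move=> x y _ _; rewrite adjacent_edges /edges /= adjacent_cons !adjacent_cat.
    rewrite adjacent_cons adjacent_nil orbF.
    by case: (adjacent D x y); rewrite /= ?orbT ?orbF -?orbA.
  + apply: (etrans (perm_uniq _)) U; rewrite /live /=.
    by count_solve.
- rewrite ltnS => sn U _; apply: path_reduce => //; apply: IHn => //.
    by move: sn; clear; move=> /=; lia.
  exact: uniq_live_reduce U.
Qed.

(** With two vertices the closing edge repeats the edge of the path; a 5-cycle reduces to this
    degenerate cycle. Three vertices form the triangle. Four are treated apart, since [u] and [v]
    then coincide. *)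
Lemma good_cycle D a s : uniq (live D [:: a :: s]) -> s != [::] ->
  good R (paths D [:: a :: s] [:: (a, last a s)]).
Proof.
have [n] := ubnP (size s); elim: n s D a => // n IHn [|b [|c [|v s]]] // D a.
- move=> _ U _; have : good R (paths D [:: [:: a; b]] [::]).
    by apply: good_paths => //; case: (D).
  apply: good_graph_eq => // x y _ _.
  rewrite !adjacent_edges /= !adjacent_cons !adjacent_nil /= !orbF.
  by do 2 case: (_ && _); rewrite ?orbT ?orbF.
- move=> _ U _; have LE : live D [:: [:: a; b; c]] =i unzip1 D ++ unzip2 D ++ [:: a; b; c].
    by apply: perm_mem; count_solve.
  have [+ _ _] := uniq_live U; rewrite /= !inE negb_or.
  move=> /and3P[/andP[/eqP ab /eqP ac] /eqP bc _].
  apply: (@good_clique D [:: a; b; c]) => //.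
  + move=> x y xL yL; rewrite /paths /graph !LE xL yL adjacent_edges.
    rewrite /= !adjacent_cons !adjacent_nil /=.
    case: (adjacent D x y); rewrite ?orbT ?orbF // !inE /=.
    case: (x =P a); case: (x =P b); case: (x =P c);
      case: (y =P a); case: (y =P b); case: (y =P c);
      by case: (x =P y) => //= *; exfalso; congruence.
  + by move=> v vL; rewrite /paths /graph LE vL.
- rewrite ltnS => sn U _; have [us _ uD] := uniq_live U.
  have uL : last v s \in v :: s by exact: mem_last.
  set u := last v s in uL *.
  have inL x : x \in [:: a, b, c, v & s] -> x \in live D [:: [:: a, b, c, v & s]].
    by move=> xs; rewrite !mem_cat xs !orbT.
  move: us; rewrite 3!cons_uniq => /and4P[h1 h2 cvs uvs].
  have [ab ac avs] : [/\ a != b, a != c & a \notin v :: s].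
    by move: h1; rewrite !inE !negb_or => /and4P[-> -> -> ->].
  have [bc bvs] : b != c /\ b \notin v :: s.
    by move: h2; rewrite !inE !negb_or => /and3P[-> -> ->].
  have au : a != u by apply/eqP => e; case/negP: avs; rewrite e; exact: uL.
  have bu : b != u by apply/eqP => e; case/negP: bvs; rewrite e; exact: uL.
  have cu : c != u by apply/eqP => e; case/negP: cvs; rewrite e; exact: uL.
  have [av bv cv] : [/\ a != v, b != v & c != v].
    by split; [move: avs | move: bvs | move: cvs]; rewrite inE negb_or => /andP[].
  have adjb X z : avoids b X ->
      adjacent (edges D [:: [:: a, b, c, v & s]] X) b z = (z == a) || (z == c).
    move=> bX; rewrite adjacent_edges_in ?inE ?eqxx ?orbT // (adjacent_avoids z bX) orbF.
    rewrite !steps_cons2 !adjacent_cons !eqxx adjacent_steps_notin // eq_sym (negbTE ab).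
    by rewrite (negbTE bc) (negbTE bv) !orbF.
  have adjc X z : avoids c X ->
      adjacent (edges D [:: [:: a, b, c, v & s]] X) c z = (z == b) || (z == v).
    move=> cX; rewrite adjacent_edges_in ?inE ?eqxx ?orbT // (adjacent_avoids z cX) orbF.
    rewrite !steps_cons2 !adjacent_cons !eqxx adjacent_steps_notin // ![c == _]eq_sym.
    by rewrite (negbTE ac) (negbTE bc) [v == c]eq_sym (negbTE cv) !orbF.
  have adjs X x z : adjacent (steps [:: a, b, c, v & s]) x z ->
      adjacent (edges D [:: [:: a, b, c, v & s]] X) x z.
    by rewrite adjacent_edges => ->; rewrite orbT.
  have adjX X x z : adjacent X x z -> adjacent (edges D [:: [:: a, b, c, v & s]] X) x z.
    by rewrite adjacent_edges => ->; rewrite !orbT.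
  have bX : avoids b [:: (a, u)] by rewrite /avoids /= ab eq_sym bu.
  (* In a 4-cycle [b] and [v] have the same neighbours [a] and [c], so [v] can be deleted and the
     path [a b c] remains. *)
  have [s0|s0] := eqVneq s [::].
    have uv : u = v by rewrite /u s0.
    rewrite [last a _]/= -/u; rewrite uv in bX *.
    apply: (@good_delete_perm _ (live D [:: [:: a; b; c]]) _
      (edges D [:: [:: a; b; c]] [::]) b v) => //.
    + by rewrite s0; count_solve.
    + by rewrite !mem_cat !inE eqxx !orbT.
    + by rewrite adjb // negb_or eq_sym ab bc.
    + by rewrite adjb // negb_or ![v == _]eq_sym av cv.
    + move=> z _; rewrite adjb // => /orP[] /eqP ->.
        by apply: adjX; rewrite !adjacent_cons !eqxx !orbT.
      by apply: adjs; rewrite !steps_cons2 !adjacent_cons !eqxx !orbT.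
    + move=> x z xv zv; rewrite !adjacent_edges s0 /= !adjacent_cons.
      by rewrite (negbTE xv) (negbTE zv) !andbF !orbF.
    + apply: good_paths; last by case: (D).
      suff : uniq (v :: live D [:: [:: a; b; c]]) by case/andP.
      by apply: (etrans (perm_uniq _)) U; rewrite s0; count_solve.
  have uv : u != v.
    apply/eqP => e; move: uvs; rewrite cons_uniq => /andP[/negP + _]; apply.
    by move: s0 e; rewrite /u; case: (s) => // x s' _ /= <-; exact: mem_last.
  rewrite [last a _]/= -/u.
  have cX : avoids c [:: (v, u)] by rewrite /avoids /= !andbT ![_ == c]eq_sym cv cu.
  have adjvu x z : adjacent [:: (v, u); (a, u)] x z =
      adjacent [:: (v, u)] x z || adjacent [:: (a, u)] x z.
    by rewrite -adjacent_cat.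
  have inLv x : x \in v :: s -> x \in live D [:: [:: a, b, c, v & s]].
    by move=> xs; apply: inL; rewrite 3!inE xs !orbT.
  (* Adding [vu]: the neighbours [a] and [c] of [b] are adjacent to [u] and [v] respectively. *)
  apply/(@good_edge _ _ _ _
    (edges D [:: [:: a, b, c, v & s]] [:: (v, u); (a, u)]) v u b) => //.
  + by apply: inLv; rewrite mem_head.
  + exact: inLv.
  + by apply: inL; rewrite !inE eqxx orbT.
  + by rewrite adjb // negb_or eq_sym ab bc.
  + by rewrite adjb // negb_or ![v == _]eq_sym av cv.
  + by rewrite adjb // negb_or ![u == _]eq_sym au cu.
  + move=> z _; rewrite adjb // => /orP[] /eqP ->; apply/orP; [right|left].
      by apply: adjX; rewrite !adjacent_cons !eqxx !orbT.
    by apply: adjs; rewrite !steps_cons2 !adjacent_cons !eqxx !orbT.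
  + move=> x z; rewrite adjacent_cons !adjacent_edges adjvu [flatten _]/= adjacent_nil.
    move: (adjacent (steps _) x z) (adjacent [:: (a, u)] x z) => P Q.
    rewrite adjacent_cons adjacent_nil.
    by case: (adjacent D x z); case: P; case: Q; do 2 case: (_ && _).
  (* Removing [ua], with [c] as witness: its neighbour [b] is adjacent to [a], and its neighbour [v]
     to [u] through the edge just added. *)
  apply: (proj1 (@good_edge R V _ (edges D [:: [:: a, b, c, v & s]] [:: (v, u)])
    (edges D [:: [:: a, b, c, v & s]] [:: (v, u); (a, u)]) u a c _ _ _ _ _ _ _ _ _ _)).
  + exact: inLv.
  + by apply: inL; rewrite mem_head.
  + by apply: inL; rewrite !inE eqxx !orbT.
  + by [].
  + by rewrite eq_sym.
  + by rewrite adjc // negb_or eq_sym bc cv.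
  + by rewrite adjc // negb_or eq_sym bu uv.
  + by rewrite adjc // negb_or ab av.
  + move=> z _; rewrite adjc // => /orP[] /eqP ->; apply/orP; [right|left].
      by apply: adjs; rewrite !steps_cons2 !adjacent_cons !eqxx ?orbT.
    by apply: adjX; rewrite !adjacent_cons !eqxx !orbT.
  + move=> x z; rewrite adjacent_cons !adjacent_edges adjvu [flatten _]/= adjacent_nil.
    move: (adjacent (steps _) x z) (adjacent [:: (v, u)] x z) => P Q.
    rewrite adjacent_cons adjacent_nil.
    by case: (adjacent D x z); case: P; case: Q; do 2 case: (_ && _).
  (* Now [a] is the free end of a path; besides [ab] there remains [v :: s], closed by [vu]. *)
  apply: (@path_reduce D a b c (v :: s) [::] [:: (v, u)] U).
    by rewrite /avoids /= !andbT ![_ == a]eq_sym av au.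
  apply: IHn; last by [].
    by move: sn; clear; move=> /=; lia.
  exact: uniq_live_reduce U.
Qed.

End Reductions.

(** * A cycle and a path sharing one vertex *)

Section Lollipop.
Variables (R : realType) (V : finType).
Implicit Types (s q l : seq V) (ps : seq (seq V)).
Implicit Types (X D : seq (V * V)) (a b c u v w : V).

Lemma good_drop D ps X :
  (forall p, p \in X -> (p.1 \notin live D ps) || (p.2 \notin live D ps)) ->
  good R (paths D ps [::]) -> good R (paths D ps X).
Proof.
move=> h; apply: good_graph_eq => // x y xL yL.
rewrite /edges cats0 !adjacent_cat; have /negbTE -> : ~~ adjacent X x y.
  by apply/negP => /orP[] /h; rewrite /= xL yL.
by rewrite orbF.
Qed.

(** The only neighbour of the leaf [w] is [c], which is adjacent to both ends of [a :: s]. Both ends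
    can thus be deleted, and with them the two edges from [c] to the cycle; two disjoint paths
    remain. *)
Lemma good_leaf_cycle D w c q a s :
  uniq (live D [:: [:: w, c & q]; a :: s]) -> s != [::] ->
  good R (paths D [:: [:: w, c & q]; a :: s] [:: (c, a); (c, last a s)]).
Proof.
case/lastP: s => // s y; rewrite last_rcons => U _.
have [us + _] := uniq_live U.
rewrite (_ : flatten _ = a :: rcons s y) => [ups|]; last exact: cats0.
have [wc wq] : w != c /\ w \notin q.
  by move: us; rewrite cons_uniq inE negb_or => /andP[/andP[]].
have ne z : z \in a :: rcons s y -> w != z.
  by move=> zs; apply/eqP => e; have := ups w (mem_head _ _); rewrite e zs.
have wa : w != a by apply: ne; rewrite mem_head.
have wy : w != y by apply: ne; rewrite inE mem_rcons mem_head orbT.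
have adjw ps X z : uniq (live D ([:: w, c & q] :: ps)) -> avoids w X ->
    adjacent (edges D ([:: w, c & q] :: ps) X) w z = (z == c).
  move=> U' wX; rewrite adjacent_edges_in ?mem_head // (adjacent_avoids z wX) orbF.
  rewrite steps_cons2 adjacent_cons eqxx (negbTE wc) adjacent_steps_notin ?orbF //.
  by rewrite inE negb_or wc.
have U1 : uniq (live D [:: [:: w, c & q]; rcons s y]).
  suff : uniq (a :: live D [:: [:: w, c & q]; rcons s y]) by case/andP.
  by apply: (etrans (perm_uniq _)) U; count_solve.
have U2 : uniq (live D [:: [:: w, c & q]; s]).
  suff : uniq (y :: live D [:: [:: w, c & q]; s]) by case/andP.
  by apply: (etrans (perm_uniq _)) U1; count_solve.
have cin : c \in [:: w, c & q] by rewrite !inE eqxx orbT.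
have ca : c != a.
  apply/eqP => e; have := ups c cin.
  by rewrite e mem_head.
have cy : c != y.
  apply/eqP => e; have := ups c cin.
  by rewrite e inE mem_rcons mem_head orbT.
have X1 : avoids w [:: (c, a); (c, y)].
  by rewrite /avoids /= ![_ == w]eq_sym wc wa wy.
have X2 : avoids w [:: (c, y)] by rewrite /avoids /= ![_ == w]eq_sym wc wy.
apply: (@good_delete_perm _ _ _ (live D [:: [:: w, c & q]; rcons s y]) _
  (edges D [:: [:: w, c & q]; rcons s y] [:: (c, y)]) w a) => //.
- by count_solve.
- by rewrite !mem_cat mem_head !orbT.
- by rewrite adjw.
- by rewrite adjw // eq_sym.
- move=> z _; rewrite adjw // => /eqP ->; rewrite adjacent_edges !adjacent_cons.
  by rewrite !eqxx !orbT.
- move=> x z xa za; rewrite !adjacent_edges /= !cats0 (@adjacent_steps_cons _ a) //.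
  by rewrite (adjacent_cons c a) (negbTE xa) (negbTE za) andbF.
apply: (@good_delete_perm _ _ _ (live D [:: [:: w, c & q]; s]) _
  (edges D [:: [:: w, c & q]; s] [::]) w y) => //.
- by count_solve.
- by rewrite !mem_cat mem_head !orbT.
- by rewrite adjw.
- by rewrite adjw // eq_sym.
- move=> z _; rewrite adjw // => /eqP ->; rewrite adjacent_edges !adjacent_cons.
  by rewrite !eqxx !orbT.
- move=> x z xy zy; rewrite !adjacent_edges /= !cats0 (@adjacent_steps_rcons _ y) //.
  by rewrite (adjacent_cons c y) (negbTE xy) (negbTE zy) andbF.
by apply: good_paths => //; case: (D).
Qed.

(** [l] is shortened by three until at most two vertices precede [c]: none is [base], one is
    [good_leaf_cycle], and with two the next reduction deletes [c] and opens the cycle. [base] is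
    quantified over [D'] since each reduction enlarges [D]. *)
Lemma good_tail D l c q a s :
  (forall D', uniq (live D' [:: c :: q; a :: s]) ->
     good R (paths D' [:: c :: q; a :: s] [:: (c, a); (c, last a s)])) ->
  uniq (live D [:: l ++ c :: q; a :: s]) -> s != [::] ->
  good R (paths D [:: l ++ c :: q; a :: s] [:: (c, a); (c, last a s)]).
Proof.
move=> base + s0; have [n] := ubnP (size l); elim: n l D => // n IHn l D ln U.
have av w : w \in l -> avoids w [:: (c, a); (c, last a s)].
  move=> wl; have [us + _] := uniq_live U.
  rewrite (_ : flatten _ = a :: s) => [ups|]; last exact: cats0.
  have h z : z \in a :: s -> z != w.
    move=> zs; apply/eqP => e; have := ups w; rewrite mem_cat wl => /(_ isT).
    by rewrite -e zs.
  have cw : c != w.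
    apply/eqP => e; move: us; rewrite cat_uniq => /and3P[_ /hasPn /(_ c)].
    by rewrite mem_head e wl => /(_ isT).
  by rewrite /avoids /= cw !h ?mem_head // mem_last.
case: l ln U av => [|w [|x [|y l]]] ln U av.
- exact: base.
- exact: good_leaf_cycle.
- apply: path_reduce => //; first by apply: av; rewrite mem_head.
  have cL : c \notin live ((w, x) :: D) [:: q; a :: s].
    suff : uniq (c :: live ((w, x) :: D) [:: q; a :: s]) by case/andP.
    by apply: (etrans (perm_uniq _)) U; count_solve.
  apply: good_drop; last by apply: good_paths; first exact: uniq_live_reduce U.
  by move=> p; rewrite !inE => /orP[] /eqP ->; rewrite cL.
- apply: path_reduce => //; first by apply: av; rewrite mem_head.
  apply: IHn; last exact: uniq_live_reduce U.
  by move: ln; clear; move=> /=; lia.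
Qed.

Lemma good_lollipop D l c q a s :
  uniq (live D [:: l ++ c :: q; a :: s]) -> s != [::] ->
  good R (paths D [:: l ++ c :: q; a :: s] [:: (c, a); (c, last a s)]).
Proof.
move=> U s0; apply: good_tail => // {U} D' U.
(* Once [l] is used up, the path is read backwards: [q] then precedes [c] and [good_tail] applies
   again. *)
have : good R (paths D' [:: rev q ++ [:: c]; a :: s] [:: (c, a); (c, last a s)]).
  apply: good_tail => // [{U} D U|]; last first.
    by apply: (etrans (perm_uniq _)) U; count_solve.
  (* No tail is left: [ca] becomes the first step of a path whose closing edge joins [c] to the last
     vertex. *)
  have : good R (paths D [:: [:: c, a & s]] [:: (c, last c (a :: s))]).
    by apply: good_cycle => //; apply: (etrans (perm_uniq _)) U; count_solve.
  apply: good_graph_eq => [|x y _ _]; first by apply: perm_mem; count_solve.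
  rewrite !adjacent_edges steps_cons2 !(adjacent_cons c) !adjacent_nil.
  rewrite (_ : flatten [seq steps i | i <- [:: a :: s]] = steps (a :: s)); last exact: cats0.
  move: (adjacent D x y) (adjacent (steps (a :: s)) x y) => P Q.
  by case: P; case: Q; do 4 case: (_ && _).
apply: good_graph_eq => [|x y _ _]; first by apply: perm_mem; count_solve.
by rewrite !adjacent_edges cats1 -rev_cons adjacent_steps_rev.
Qed.

End Lollipop.

(** * The wedge of a cycle and a path *)

Lemma steps_map_iota (V : finType) (f : nat -> V) a len x y :
  reflect (exists i, [/\ (a <= i)%N, (i.+1 < a + len)%N, x = f i & y = f i.+1])
    ((x, y) \in steps (map f (iota a len))).
Proof.
apply: (iffP idP); elim: len a => [|[|len] IH] a //.
- rewrite -[steps _]/((f a, f a.+1) :: steps (map f (iota a.+1 len.+1))).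
  rewrite in_cons xpair_eqE => /orP[/andP[/eqP-> /eqP->]|/IH[i [ai il -> ->]]].
    by exists a; split => //; lia.
  by exists i; split => //; lia.
- by case=> i [ai il]; lia.
- by case=> i [ai il]; lia.
- case=> i [ai il xi yi].
  rewrite -[steps _]/((f a, f a.+1) :: steps (map f (iota a.+1 len.+1))).
  rewrite in_cons; have [ia|ia] := eqVneq i a; first by rewrite xi yi ia eqxx.
  by apply/orP; right; apply: IH; exists i; split => //; lia.
Qed.

Section Wedge.
Variables (n m k : nat) (hn : (3 <= n)%N) (hm : (1 <= m)%N).
Variable hk : (1 <= k <= uphalf m)%N.

Local Notation a1 := (cycle_first hn).
Local Notation bk := (path_vertex hm hk).
Local Notation G := (graph_wedge a1 bk).

Definition cycle_vertex (i : nat) : G := @wedge_proj _ _ a1 bk (inl (insubd a1 i)).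
Definition tail_vertex (i : nat) : G := @wedge_proj _ _ a1 bk (inr (insubd bk i)).

(** The defaults 0 and [k.-1] are the positions of the wedge point. So every vertex of the tail has
    cycle index 0, whereas those of [cycle_path] have a positive one. *)
Definition cycle_index (u : G) : nat := if u is inl a then val a else 0%N.
Definition tail_index (u : G) : nat := if u is inr w then val (val w) else k.-1.

Lemma cycle_vertexK i : (i < n)%N -> cycle_index (cycle_vertex i) = i.
Proof. by move=> i_n; rewrite /= val_insubd i_n. Qed.

Lemma tail_vertexK i : (i < m)%N -> tail_index (tail_vertex i) = i.
Proof.
move=> i_m; rewrite /tail_vertex /=; case: insubP => [w _ we|]; rewrite /tail_index.
  by rewrite we val_insubd i_m.
by rewrite negbK => /eqP/(congr1 val); rewrite val_insubd i_m /= => ->.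
Qed.

Lemma cycle_index_tail i : cycle_index (tail_vertex i) = 0%N.
Proof. by rewrite /tail_vertex /=; case: insubP. Qed.

Lemma tail_center : tail_vertex k.-1 = cycle_vertex 0.
Proof.
have e : insubd bk k.-1 = bk.
  by apply: val_inj; rewrite val_insubd; case: ifP.
have e0 : insubd a1 0%N = a1 by apply: val_inj; rewrite val_insubd; case: ifP.
rewrite /tail_vertex /cycle_vertex e e0 /=; case: insubP => [w + we|//].
by rewrite eqxx.
Qed.

Lemma cycle_vertexE (u : 'I_n) : cycle_vertex u = inl u.
Proof. by rewrite /cycle_vertex (valKd (_ : cycle_graph hn)). Qed.

Lemma tail_vertexE (u : 'I_m) : tail_vertex u = @wedge_proj _ _ a1 bk (inr u).
Proof. by rewrite /tail_vertex (valKd (_ : path_graph m)). Qed.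

Lemma adj_cycle i j : (i < n)%N -> (j < n)%N -> j = (i.+1 %% n)%N ->
  adj (cycle_vertex i) (cycle_vertex j).
Proof.
move=> i_n j_n ji; apply/existsP; exists (inl (insubd a1 i)).
apply/existsP; exists (inl (insubd a1 j)); rewrite !eqxx !andbT /=.
by rewrite /cycle_adj !val_insubd i_n j_n -ji eqxx.
Qed.

Lemma adj_tail i : (i.+1 < m)%N -> adj (tail_vertex i) (tail_vertex i.+1).
Proof.
move=> i_m; apply/existsP; exists (inr (insubd bk i)).
apply/existsP; exists (inr (insubd bk i.+1)); rewrite !eqxx !andbT /=.
by rewrite /path_adj !val_insubd i_m (ltnW i_m) eqxx.
Qed.

(** The wedge point is listed once, in [tail_path]; [cycle_path] therefore starts at index 1, and
    [closing_edges] joins its two ends to the wedge point. *)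
Definition tail_path : seq G := map tail_vertex (iota 0 m).
Definition cycle_path : seq G := map cycle_vertex (iota 1 n.-1).
Definition closing_edges : seq (G * G) :=
  [:: (cycle_vertex 0, cycle_vertex 1); (cycle_vertex 0, cycle_vertex n.-1)].

Lemma uniq_wedge : uniq (live [::] [:: tail_path; cycle_path]).
Proof.
rewrite /live /= cats0 cat_uniq; apply/and3P; split.
- rewrite map_inj_in_uniq ?iota_uniq // => i j.
  rewrite !mem_iota add0n /= => i_m j_m /(congr1 tail_index).
  by rewrite !tail_vertexK.
- apply/hasPn => u /mapP[i]; rewrite mem_iota => i_n ->; apply/negP => /mapP[j _].
  by move/(congr1 cycle_index); rewrite cycle_index_tail cycle_vertexK; lia.
- rewrite map_inj_in_uniq ?iota_uniq // => i j.
  rewrite !mem_iota => i_n j_n /(congr1 cycle_index).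
  by rewrite !cycle_vertexK; lia.
Qed.

Lemma live_wedge (u : G) : u \in live [::] [:: tail_path; cycle_path].
Proof.
rewrite /live /= cats0 mem_cat; case: u => [u|w].
  rewrite -cycle_vertexE; have un := ltn_ord u.
  have [u0|u0] := eqVneq (nat_of_ord u) 0%N.
    rewrite u0 -tail_center map_f // mem_iota; exact: path_vertex_lt hm hk.
  by apply/orP; right; apply: map_f; rewrite mem_iota; move: u0 un => /=; lia.
apply/orP; left; apply/mapP; exists (nat_of_ord (val w)).
  by rewrite mem_iota /=.
rewrite tail_vertexE /=; case: insubP => [w' _ /val_inj -> //|].
by rewrite (valP w).
Qed.

Lemma adj_wedge : (adj : rel G) = paths [::] [:: tail_path; cycle_path] closing_edges.
Proof.
apply/funext => u; apply/funext => v.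
rewrite /paths /graph !live_wedge adjacent_edges /= cats0.
have key x y : (x, y) \in steps tail_path ++ steps cycle_path ++ closing_edges -> adj x y.
  rewrite !mem_cat.
  case/or3P=> [/steps_map_iota[i [_ i_m -> ->]]|/steps_map_iota[i [i1 i_n -> ->]]|].
  - exact: adj_tail.
  - by apply: adj_cycle; rewrite ?modn_small //; lia.
  - rewrite !inE !xpair_eqE => /orP[] /andP[/eqP -> /eqP ->].
      by apply: adj_cycle; rewrite ?modn_small //; lia.
    by rewrite adj_sym; apply: adj_cycle; rewrite ?prednK ?modnn //; lia.
apply/idP/idP; last first.
  rewrite -!adjacent_cat => /orP[/key //|/key]; rewrite adj_sym; exact.
suff key' x y : adj (x : graph_sum (cycle_graph hn) (path_graph m)) y ->
    adjacent (steps tail_path ++ steps cycle_path ++ closing_edges)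
      (@wedge_proj _ _ a1 bk x) (@wedge_proj _ _ a1 bk y).
  move=> /existsP[x /existsP[y /and3P[xy /eqP <- /eqP <-]]].
  by have := key' x y xy; rewrite !adjacent_cat.
case: x y => [x|x] [y|y] //=.
- rewrite -!cycle_vertexE.
  wlog h : x y / nat_of_ord y = (x.+1 %% n)%N.
    by move=> wl /orP[/eqP h|/eqP h]; [|rewrite adjacent_sym]; apply: wl => //;
      rewrite /cycle_adj h eqxx ?orbT.
  move=> _; have xn := ltn_ord x; rewrite !adjacent_cat.
  (* The edge leaving 0 and the edge returning to 0 are the closing edges; all others are steps of
     [cycle_path]. *)
  have [xl|xl] := ltnP x.+1 n.
    rewrite modn_small // in h; have [x0|x0] := posnP x.
      by rewrite h x0 /adjacent !inE eqxx !orbT.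
    apply/or3P; apply: Or32; apply/orP; left; apply/steps_map_iota.
    by exists x; split => //; [lia | rewrite h].
  have xe : nat_of_ord x = n.-1 by lia.
  rewrite xe prednK ?modnn in h; last by lia.
  by rewrite h xe /adjacent !inE eqxx !orbT.
- wlog h : x y / nat_of_ord y = x.+1.
    by move=> wl /orP[/eqP h|/eqP h]; [|rewrite adjacent_sym]; apply: wl => //;
      rewrite /path_adj h eqxx ?orbT.
  move=> _; rewrite -/(@wedge_proj _ _ a1 bk (inr x)) -/(@wedge_proj _ _ a1 bk (inr y)).
  rewrite -!tail_vertexE !adjacent_cat; apply/or3P; apply: Or31; apply/orP; left.
  apply/steps_map_iota; exists x; split => //; last by rewrite h.
  by rewrite -h add0n.
Qed.

Lemma good_wedge (R : realType) : good R (adj : rel G).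
Proof.
rewrite adj_wedge; have U := uniq_wedge.
have k_m := path_vertex_lt hm hk.
have k0 : (0 < k)%N by case/andP: hk.
(* The wedge point has [k.-1] path vertices before it and [m - k] after it. *)
have tE : tail_path = map tail_vertex (iota 0 k.-1) ++
    cycle_vertex 0 :: map tail_vertex (iota k (m - k)).
  rewrite /tail_path -tail_center -map_cons -map_cat; congr map.
  have -> : iota 0 m = iota 0 (k.-1 + (m - k).+1).
    by congr iota; move: k_m k0; clear; lia.
  by rewrite iotaD add0n /= prednK.
have cE : cycle_path = cycle_vertex 1 :: map cycle_vertex (iota 2 n.-2).
  by rewrite /cycle_path -[n.-1]prednK //; move: hn; clear; lia.
have lE : cycle_vertex n.-1 = last (cycle_vertex 1) (map cycle_vertex (iota 2 n.-2)).
  rewrite last_map; congr cycle_vertex.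
  have lastE p j : last j (iota j.+1 p) = (j + p)%N.
    by elim: p j => [|p IH] j /=; rewrite ?addn0 // IH addSnnS.
  by rewrite lastE; move: hn; clear; lia.
rewrite /closing_edges lE tE cE; apply: good_lollipop; first by rewrite -tE -cE.
by rewrite -size_eq0 size_map size_iota; move: hn; clear; lia.
Qed.

End Wedge.

Theorem theorem3p7 (R : realType) (n m k : nat) (hn : (3 <= n)%N)
    (hm : (1 <= m)%N) (hk : (1 <= k <= uphalf m)%N) :
  let G := graph_wedge (cycle_first hn) (path_vertex hm hk) in
  let X := realization R (independence_complex G) in
  contractible R X \/
  exists (r : nat) (d : 'I_r.+1 -> nat),
    homotopy_equivalent R X (wedge_of_spheres R d).
Proof.
move=> G X; have := good_wedge hn hm hk R; rewrite /good /stable_space.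
(* [stable] and [independent] unfold to the same formula, so the two complexes differ at most in
   their proofs of closure under subsets. *)
suff -> : stable_complex (adj : rel G) = independence_complex G by [].
rewrite /stable_complex /independence_complex.
by congr SComplex; exact: Prop_irrelevance.
Qed.
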